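(* Let $p$ be a prime number or zero and let $(F,K;\chi)$ be a model of $\mathrm{ACFC}_p$. If $X\subseteq K^n$ is definable, then $X$ is a boolean combination of algebraically presentable subsets of $K^n$. Furthermore, if $X$ is $0$-definable, then $X$ is a boolean combination of $0$-algebraically presentable subsets of $K^n$.
   Context: A character $\chi:F\to K$ between integral domains is a map with $\chi(ab)=\chi(a)\chi(b)$ for all $a,b\in F$, $\chi(0)=0$ and $\chi(1)=1$. A structure $(F,K;\chi)$ of this kind is a structure in the $2$-sorted language $L$, which consists of two disjoint copies of the language of rings (one for each sort) augmented by a unary function symbol $\chi$ from the first sort to the second. For $n\ge 1$, $\alpha\in F^n$ and $k\in\mathbb{N}^n$ put $\alpha^k=\alpha_1^{k_1}\cdots\alpha_n^{k_n}$. The tuple $\alpha$ is multiplicatively dependent if $\alpha^k=\alpha^l$ for some distinct $k,l\in\mathbb{N}^n$, and multiplicatively independent otherwise. A character $\chi:F\to K$ is generic if it is injective and, for every $n\ge1$ and every multiplicatively independent $\alpha\in F^n$, the tuple $\chi(\alpha)=(\chi(\alpha_1),\dots,\chi(\alpha_n))$ is algebraically independent, in the fraction field of $K$, over its prime field. $\mathrm{ACFC}$ is a recursive set of $\forall\exists$-sentences of $L$ whose models are exactly the structures $(F,K;\chi)$ with $F,K$ algebraically closed fields, $\mathrm{char}(K)=0$ and $\chi$ a generic character. For $p$ prime or zero, $\mathrm{ACFC}_p$ is $\mathrm{ACFC}$ together with sentences expressing $\mathrm{char}(F)=p$. In the fixed model $(F,K;\chi)$, definable means definable in the $L$-structure $(F,K;\chi)$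 with parameters, and $0$-definable means definable without parameters. A family $(X_b)_{b\in Y}$ of subsets of $K^n$ is definable (resp. $0$-definable) if both $Y$ and $\{(a,b)\in K^n\times Y: a\in X_b\}$ are definable (resp. $0$-definable). A $K$-algebraic subset of $K^n$ is a Zariski closed subset (with polynomials over $K$). A set $S\subseteq K^n$ is algebraically presentable if $S=\bigcup_{\alpha\in D}V_\alpha$ for some $k$, some definable $D\subseteq F^k$ and some definable family $(V_\alpha)_{\alpha\in D}$ of $K$-algebraic subsets of $K^n$; it is $0$-algebraically presentable if such a family $(V_\alpha)_{\alpha\in D}$ can be chosen to be $0$-definable. *)

(* Defs.v *)
From HB Require Import structures.
From mathcomp Require Import all_boot all_order all_algebra.
From mathcomp Require Import mpoly.
From mathcomp Require Import boolp classical_sets.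

Set Implicit Arguments.
Unset Strict Implicit.
Unset Printing Implicit Defensive.

Import GRing.Theory.

Local Open Scope ring_scope.
Local Open Scope classical_set_scope.

Definition has_char (p : nat) (R : nzRingType) : Prop :=
  if p is 0 then [pchar R] =i pred0 else p \in [pchar R].

(* The intersection of all subfields. *)
Definition prime_field (E : fieldType) : set E :=
  [set x | forall S : {pred E}, divring_closed S -> x \in S].

Arguments prime_field : clear implicits.

Definition alg_independent (E : fieldType) (k : set E) (n : nat)
    (x : n.-tuple E) : Prop :=
  forall P : {mpoly E[n]},
    (forall m, k P@_m) -> P.@[tnth x] = 0 -> P = 0.

Definition tuple_exp (R : comNzRingType) (n : nat) (a : n.-tuple R)
    (k : n.-tuple nat) : R :=
  \prod_(i < n) tnth a i ^+ tnth k i.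

Definition mul_dependent (R : comNzRingType) (n : nat) (a : n.-tuple R) : Prop :=
  exists k l : n.-tuple nat, k <> l /\ tuple_exp a k = tuple_exp a l.

Definition character (F K : idomainType) (chi : F -> K) : Prop :=
  [/\ {morph chi : a b / a * b}, chi 0 = 0 & chi 1 = 1].

Definition generic_character (F K : idomainType) (chi : F -> K) : Prop :=
  [/\ character chi, injective chi
    & forall n (a : n.-tuple F), (0 < n)%N -> ~ mul_dependent a ->
        alg_independent (prime_field {fraction K})
          (map_tuple (fun b => tofrac (chi b)) a)].

(* The models of ACFC are exactly the structures satisfying the first two     *)
(* conditions, for algebraically closed F and K.                              *)
Definition ACFC_model (p : nat) (F K : closedFieldType) (chi : F -> K) : Prop :=
  [/\ has_char 0 K, generic_character chi & has_char p F].

(* The two-sorted language of (F, K; chi).  Terms and formulas are            *)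
(* well-scoped: [m] counts the free variables of the first sort and [n] those *)
(* of the second.  A quantifier binds variable 0 of its sort and shifts the   *)
(* others by one.                                                             *)
Inductive lsort : Type := SortF | SortK.

Inductive term (m n : nat) : lsort -> Type :=
| VarF of 'I_m : term m n SortF
| VarK of 'I_n : term m n SortK
| Zero s : term m n s
| One s : term m n s
| Add s of term m n s & term m n s : term m n s
| Opp s of term m n s : term m n s
| Mul s of term m n s & term m n s : term m n s
| Chi of term m n SortF : term m n SortK.

(* Disjunction, implication and universal quantification are the usual        *)
(* (classical) abbreviations.                                                 *)
Inductive formula (m n : nat) : Type :=
| Eq s of term m n s & term m n s
| Not of formula m n
| And of formula m n & formula m n
| ExF of formula m.+1 n
| ExK of formula m n.+1.

Definition carrier (F K : idomainType) (s : lsort) : idomainType :=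
  if s is SortF then F else K.

Fixpoint eval (F K : idomainType) (chi : F -> K) (m n : nat)
    (a : m.-tuple F) (x : n.-tuple K) (s : lsort) (t : term m n s) :
    carrier F K s :=
  match t in term _ _ s return carrier F K s with
  | VarF i => tnth a i
  | VarK i => tnth x i
  | Zero s => 0
  | One s => 1
  | Add s t u => eval chi a x t + eval chi a x u
  | Opp s t => - eval chi a x t
  | Mul s t u => eval chi a x t * eval chi a x u
  | Chi t => chi (eval chi a x t)
  end.

Fixpoint holds (F K : idomainType) (chi : F -> K) (m n : nat)
    (a : m.-tuple F) (x : n.-tuple K) (f : formula m n) : Prop :=
  match f with
  | Eq s t u => eval chi a x t = eval chi a x u
  | Not f => ~ holds chi a x f
  | And f g => holds chi a x f /\ holds chi a x g
  | ExF f => exists b : F, holds chi (cons_tuple b a) x f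
  | ExK f => exists y : K, holds chi a (cons_tuple y x) f
  end.

Section Definability.
Variables (F K : idomainType) (chi : F -> K).

Definition definable0 (m n : nat) (X : set (m.-tuple F * n.-tuple K)) : Prop :=
  exists f : formula m n, X = [set u | holds chi u.1 u.2 f].

(* [c] and [d] are the parameters from the two sorts. *)
Definition definable (m n : nat) (X : set (m.-tuple F * n.-tuple K)) : Prop :=
  exists m' n' (c : m'.-tuple F) (d : n'.-tuple K)
         (f : formula (m + m') (n + n')),
    X = [set u | holds chi (cat_tuple u.1 c) (cat_tuple u.2 d) f].

(* Subsets of F^m and of K^n are viewed in F^m x K^0 and in F^0 x K^n. *)
Definition setF (m : nat) (D : set (m.-tuple F)) :
  set (m.-tuple F * 0.-tuple K) := D `*` setT.
Definition setK (n : nat) (X : set (n.-tuple K)) :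
  set (0.-tuple F * n.-tuple K) := setT `*` X.

Definition algebraic (n : nat) (V : set (n.-tuple K)) : Prop :=
  exists I : set {mpoly K[n]},
    V = [set x | forall P, I P -> P.@[tnth x] = 0].

(* [dfn] is to be [definable] or [definable0]. *)
Definition presentable (dfn : forall m n, set (m.-tuple F * n.-tuple K) -> Prop)
    (n : nat) (S : set (n.-tuple K)) : Prop :=
  exists k (D : set (k.-tuple F)) (V : k.-tuple F -> set (n.-tuple K)),
    [/\ dfn k 0%N (setF D),
        dfn k n [set u | D u.1 /\ V u.1 u.2],
        (forall a, D a -> algebraic (V a))
      & S = \bigcup_(a in D) V a].

Definition algebraically_presentable (n : nat) (S : set (n.-tuple K)) : Prop :=
  @presentable definable n S.
Definition algebraically_presentable0 (n : nat) (S : set (n.-tuple K)) : Prop :=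
  @presentable definable0 n S.

End Definability.

Arguments setF {F} K {m} D.
Arguments setK F {K n} X.
Arguments algebraically_presentable {F K} chi {n} S.
Arguments algebraically_presentable0 {F K} chi {n} S.

Inductive boolean_combination (T : Type) (G : set T -> Prop) : set T -> Prop :=
| BoolGen A of G A : boolean_combination G A
| BoolC A of boolean_combination G A : boolean_combination G (~` A)
| BoolI A B of boolean_combination G A & boolean_combination G B :
    boolean_combination G (A `&` B)
| BoolU A B of boolean_combination G A & boolean_combination G B :
    boolean_combination G (A `|` B).

(* Main.v *)
Require Import Defs.
From mathcomp Require Import all_boot all_order all_algebra.
From mathcomp Require Import mpoly boolp classical_sets.
From mathcomp Require Import zify ring.

Set Implicit Arguments.
Unset Strict Implicit.
Unset Printing Implicit Defensive.

Import GRing.Theory.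

(** Call a predicate of [(a, x)], with [a] in the first sort and [x] in the
second, bounded when it is built from definable conditions on [a] alone and from
polynomial equations over Z in [x] and the values [chi (a_i)], using boolean
connectives and quantifiers over F only. The proof has two halves.

Every definable predicate is bounded ([bdd_holds]). The point is to eliminate
[exists y : K] in front of a bounded predicate ([bdd_exK]). After merging the
equations that occur, a single polynomial [Q(b, x)] in the variable [y] matters,
with [b] ranging over tuples of F. If [y] is generic over [x], meaning that
[Q(b, x)(y) = 0] forces all coefficients of [Q(b, x)] to vanish, then what [y]
satisfies is read off from these coefficients; and a generic [y] always exists,
indeed a large integer will do ([small_integer]). If [y] is not generic, it is
one of at most [d] roots of some nonzero [Q(b0, x)]. Then the statement that
each of these roots has its own tuple [b] with some property amounts to the
existence of [d] tuples that jointly serve all the roots, and the quantifier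
over the roots is removed by elimination in one variable ([bdd_common_root]).

That integers are generic is where the character enters. Let Z[chi F^*] be the
ring generated by the values of [chi] on nonzero elements. A nonzero element of
this ring which is a signed sum of [T] values of [chi] is not divisible by any
integer [N > T] ([not_divisible_nonzero]). For a multiplicatively independent
tuple this is a remark on the coefficients of integer polynomials, because
genericity makes the values of [chi] algebraically independent
([not_divisible_free]). Finitely many nonzero elements of F are torsion over an
independent tuple chosen among them, and the property passes to torsion
extensions: if [c = N e], then [c^k = N^k e^k], where [c^k] has coordinates of
length at most [T^k B] over the smaller ring, and [T^k B < N^k] for large [k]
([not_divisible_adjoin]). Hence, if [c_0 + c_1 N + ... + c_d N^d = 0] with short
[c_j], all [c_j] vanish. Coefficients involving [x] are reduced to this case by
expressing the finitely many monomials in [x] over a linearly independent family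
([free_span]).

Moreover, every bounded predicate in [x] is a boolean combination of
presentable ones. A polynomial equation [q(b, x) = 0] says that a vector [c(b)]
of coefficients is orthogonal to the vector of monomials of [x]. So the set of
all [b] with [q(b, x) = 0] consists of those [b] for which [c(b)] lies in the
span of the rows [c(beta_i)], for any maximal independent family [beta] of such
tuples. The truth of a bounded predicate at [x] is therefore a condition on
[beta] alone ([bdd_determined]), and the locus where the maximal size of [beta]
is [r] is a boolean combination of presentable sets ([bdd_boolean_combination]).
*)

(** * Definable predicates *)

Section Assignments.
Variable A : Type.

Definition join (V T : Type) (a : V -> A) (b : T -> A) : V + T -> A :=
  fun s => match s with inl v => a v | inr t => b t end.

Lemma oapp_omap V V' (r : V' -> V) (a : V -> A) b :
  oapp a b \o omap r = oapp (a \o r) b.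
Proof. by apply: funext => -[]. Qed.

(** A single existential step suffices for a block of variables: a finite type is
exhausted one element at a time.  It is stated for an abstract class of predicates
because it serves both sorts, and both definable and bounded predicates. *)
Lemma ex_block (B : Type)
    (C : forall V : finType, ((V -> A) -> B -> Prop) -> Prop)
    (Cren : forall (V V' : finType) (r : V -> V') (G : (V -> A) -> B -> Prop),
      C V G -> C V' (fun a x => G (a \o r) x))
    (Cex : forall (V : finType) (G : (option V -> A) -> B -> Prop),
      C (option V) G -> C V (fun a x => exists b, G (oapp a b) x))
    (V T : finType) (G : (V + T -> A) -> B -> Prop) :
  C (V + T)%type G -> C V (fun a x => exists b, G (join a b) x).
Proof.
have blockI n : forall (G : (V + 'I_n -> A) -> B -> Prop),
    C (V + 'I_n)%type G -> C V (fun a x => exists b, G (join a b) x).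
  elim: n => [|n IHn] H CH.
    pose r (w : V + 'I_0) : V :=
      match w with inl v => v | inr (Ordinal _ lti) => False_rect V (notF lti) end.
    have -> : (fun a x => exists b, H (join a b) x) = fun a x => H (a \o r) x.
      apply: funext => a; apply: funext => x; apply: propext; split=> [[b]|Hr].
        by congr (H _ x); apply: funext => -[|[]].
      have b0 (i : 'I_0) : A by case: i.
      by exists b0; move: Hr; congr (H _ x); apply: funext => -[|[]].
    exact: Cren.
  pose r (w : V + 'I_n.+1) : option (V + 'I_n)%type :=
    match w with
    | inl v => Some (inl v)
    | inr i => omap inr (unlift ord0 i)
    end.
  have := IHn _ (Cex _ _ (Cren _ _ r _ CH)).
  congr C; apply: funext => a; apply: funext => x; apply: propext.
  split=> [[b [c Hbc]]|[b Hb]].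
    exists (fun i => oapp b c (unlift ord0 i)).
    move: Hbc; congr (H _ x); apply: funext => -[v|i] //=.
    by case: unliftP.
  exists (b \o lift ord0), (b ord0).
  move: Hb; congr (H _ x); apply: funext => -[v|i] //=.
  by case: unliftP => [j ->|->].
move=> CG.
pose r (w : V + T) : V + 'I_#|T| :=
  match w with inl v => inl v | inr t => inr (enum_rank t) end.
have := blockI _ _ (Cren _ _ r _ CG).
congr C; apply: funext => a; apply: funext => x; apply: propext.
split=> [[b Hb]|[b Hb]].
  by exists (b \o enum_rank); move: Hb; congr (G _ x); apply: funext => -[].
exists (b \o enum_val); move: Hb; congr (G _ x); apply: funext => -[] //= t.
by rewrite enum_rankK.
Qed.

End Assignments.

Section Renaming.

(** De Bruijn lifting of a renaming under one quantifier. *)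
Definition lift_ren m m' (r : 'I_m -> 'I_m') (i : 'I_m.+1) : 'I_m'.+1 :=
  oapp (lift ord0 \o r) ord0 (unlift ord0 i).

Fixpoint term_ren m n m' n' (r : 'I_m -> 'I_m') (q : 'I_n -> 'I_n') s
    (t : term m n s) : term m' n' s :=
  match t with
  | VarF i => VarF _ (r i)
  | VarK i => VarK _ (q i)
  | Zero s => Zero _ _ s
  | One s => One _ _ s
  | Add s t u => Add (term_ren r q t) (term_ren r q u)
  | Opp s t => Opp (term_ren r q t)
  | Mul s t u => Mul (term_ren r q t) (term_ren r q u)
  | Chi t => Chi (term_ren r q t)
  end.

Fixpoint formula_ren m n m' n' (r : 'I_m -> 'I_m') (q : 'I_n -> 'I_n')
    (f : formula m n) : formula m' n' :=
  match f with
  | Eq s t u => Eq (term_ren r q t) (term_ren r q u)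
  | Not f => Not (formula_ren r q f)
  | And f g => And (formula_ren r q f) (formula_ren r q g)
  | ExF f => ExF (formula_ren (lift_ren r) q f)
  | ExK f => ExK (formula_ren r (lift_ren q) f)
  end.

Lemma tnth_cons_lift T m m' (r : 'I_m -> 'I_m') (a : m.-tuple T)
    (a' : m'.-tuple T) b :
  (forall i, tnth a' (r i) = tnth a i) ->
  forall i, tnth (cons_tuple b a') (lift_ren r i) = tnth (cons_tuple b a) i.
Proof.
move=> Ha i; rewrite /lift_ren; case: unliftP => [j ->|->] //=.
by rewrite !tnthS Ha.
Qed.

Variables (F K : idomainType) (chi : F -> K).

Lemma eval_ren m n m' n' (r : 'I_m -> 'I_m') (q : 'I_n -> 'I_n') s
    (t : term m n s) a a' x x' :
  (forall i, tnth a' (r i) = tnth a i) -> (forall i, tnth x' (q i) = tnth x i) ->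
  eval chi a' x' (term_ren r q t) = eval chi a x t.
Proof.
move=> Ha Hx.
by elim: t => //= [s' t -> u ->|s' t ->|s' t -> u ->|t ->].
Qed.

Lemma holds_ren m n m' n' (r : 'I_m -> 'I_m') (q : 'I_n -> 'I_n')
    (f : formula m n) a a' x x' :
  (forall i, tnth a' (r i) = tnth a i) -> (forall i, tnth x' (q i) = tnth x i) ->
  holds chi a' x' (formula_ren r q f) <-> holds chi a x f.
Proof.
elim: f m' n' r q a a' x x' => {m n}
  [m n s t u|m n f IH|m n f IHf g IHg|m n f IH|m n f IH] m' n' r q a a' x x' Ha Hx /=.
- by rewrite !(eval_ren _ Ha Hx).
- by rewrite (IH _ _ r q a a' x x').
- by rewrite (IHf _ _ r q a a' x x') // (IHg _ _ r q a a' x x').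
- split=> -[b Hb]; exists b.
    by apply/(IH _ _ (lift_ren r) q _ (cons_tuple b a') _ x') => //; exact: tnth_cons_lift.
  by apply/(IH _ _ (lift_ren r) q (cons_tuple b a) _ x _) => //; exact: tnth_cons_lift.
- split=> -[b Hb]; exists b.
    by apply/(IH _ _ r (lift_ren q) _ a' _ (cons_tuple b x')) => //; exact: tnth_cons_lift.
  by apply/(IH _ _ r (lift_ren q) a _ (cons_tuple b x) _) => //; exact: tnth_cons_lift.
Qed.

End Renaming.

Section Definable.
Variables (F K : idomainType) (chi : F -> K).
Implicit Types V W T : finType.

Definition tuple_of (A : Type) V (a : V -> A) : #|V|.-tuple A :=
  mktuple (fun i : 'I_#|V| => a (enum_val i)).

(** Variables are indexed by arbitrary finite types, so that blocks of variables are
sums of types and renamings are plain functions; the formula only sees the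
enumeration of these types. *)
Definition dfn V W (G : (V -> F) -> (W -> K) -> Prop) : Prop :=
  exists f : formula #|V| #|W|,
    forall a x, G a x <-> holds chi (tuple_of a) (tuple_of x) f.

Lemma dfn_ext V W (G H : (V -> F) -> (W -> K) -> Prop) :
  (forall a x, G a x <-> H a x) -> dfn G -> dfn H.
Proof. by move=> GH [f Hf]; exists f => a x; rewrite -GH. Qed.

Lemma dfn_not V W (G : (V -> F) -> (W -> K) -> Prop) :
  dfn G -> dfn (fun a x => ~ G a x).
Proof. by case=> f Hf; exists (Not f) => a x; rewrite Hf. Qed.

Lemma dfn_and V W (G H : (V -> F) -> (W -> K) -> Prop) :
  dfn G -> dfn H -> dfn (fun a x => G a x /\ H a x).
Proof. by move=> [f Hf] [g Hg]; exists (And f g) => a x; rewrite Hf Hg. Qed.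

Lemma dfn_term V W s (t u : term #|V| #|W| s) :
  dfn (fun a x => eval chi (tuple_of a) (tuple_of x) t =
                  eval chi (tuple_of a) (tuple_of x) u).
Proof. by exists (Eq t u). Qed.

Lemma dfn_true V W : @dfn V W (fun _ _ => True).
Proof. by apply: dfn_ext (dfn_term (Zero _ _ SortF) (Zero _ _ SortF)). Qed.

Lemma dfn_ren V W V' W' (r : V -> V') (q : W -> W') G :
  dfn G -> @dfn V' W' (fun a x => G (a \o r) (x \o q)).
Proof.
case=> f Hf.
exists (formula_ren (fun i => enum_rank (r (enum_val i)))
                    (fun i => enum_rank (q (enum_val i))) f) => a x.
rewrite Hf; symmetry; apply: holds_ren => i;
  by rewrite !tnth_mktuple enum_rankK.
Qed.

Let split_var V (i : 'I_#|{: option V}|) : 'I_#|V|.+1 :=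
  oapp (lift ord0 \o enum_rank) ord0 (enum_val i : option V).

Lemma tnth_split_var A V (a : V -> A) b (i : 'I_#|{: option V}|) :
  tnth (cons_tuple b (tuple_of a)) (split_var i) = tnth (tuple_of (oapp a b)) i.
Proof.
rewrite tnth_mktuple /split_var; case: (enum_val i) => [v|] //=.
by rewrite tnthS tnth_mktuple enum_rankK.
Qed.

Lemma dfn_exF V W (G : (option V -> F) -> (W -> K) -> Prop) :
  dfn G -> dfn (fun a x => exists b, G (oapp a b) x).
Proof.
case=> f Hf; exists (ExF (formula_ren (@split_var V) id f)) => a x /=.
by split=> -[b Hb]; exists b; move: Hb; rewrite Hf;
  apply holds_ren => // i; rewrite tnth_split_var.
Qed.

Lemma dfn_exK V W (G : (V -> F) -> (option W -> K) -> Prop) :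
  dfn G -> dfn (fun a x => exists y, G a (oapp x y)).
Proof.
case=> f Hf; exists (ExK (formula_ren id (@split_var W) f)) => a x /=.
by split=> -[b Hb]; exists b; move: Hb; rewrite Hf;
  apply holds_ren => // i; rewrite tnth_split_var.
Qed.

Lemma dfn_exKs V W T (G : (V -> F) -> (W + T -> K) -> Prop) :
  dfn G -> dfn (fun a x => exists y, G a (join x y)).
Proof.
move=> dG.
apply: (@ex_block K (V -> F) (fun U H => dfn (fun a x => H x a)) _ _ _ _
   (fun x a => G a x)) => // [U U' r H|U H].
  exact: (@dfn_ren V U V U' id r).
exact: dfn_exK.
Qed.

Lemma dfn_all V W (I : finType) (G : I -> (V -> F) -> (W -> K) -> Prop) :
  (forall i, dfn (G i)) -> dfn (fun a x => forall i, G i a x).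
Proof.
move=> dG.
suff: forall s : seq I, dfn (fun a x => forall i, i \in s -> G i a x).
  move=> /(_ (enum I)); apply: dfn_ext => a x.
  by split=> H i; [apply: H; rewrite mem_enum|move=> _].
elim=> [|i s IHs]; first by apply: dfn_ext (dfn_true _ _).
apply: dfn_ext (dfn_and (dG i) IHs) => a x; split=> [[Hi Hs] j|H].
  by rewrite inE => /predU1P[->|/Hs].
by split=> [|j js]; apply: H; rewrite inE ?eqxx // js orbT.
Qed.

Lemma dfn_ord m n (G : ('I_m -> F) -> ('I_n -> K) -> Prop) : dfn G ->
  exists f : formula m n,
    forall (a : m.-tuple F) (x : n.-tuple K),
      G (tnth a) (tnth x) <-> holds chi a x f.
Proof.
case=> f Hf; exists (formula_ren enum_val enum_val f) => a x; rewrite Hf.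
by symmetry; apply: holds_ren => i; rewrite tnth_mktuple.
Qed.

End Definable.

(** * Sums of bounded length of character values *)

Section SignedSums.
Local Open Scope ring_scope.
Variables (F : fieldType) (K : idomainType) (chi : F -> K).
Hypothesis chi_char : character chi.

Let chiM : {morph chi : a b / a * b}. Proof. by case: chi_char. Qed.
Let chi0 : chi 0 = 0. Proof. by case: chi_char. Qed.
Let chi1 : chi 1 = 1. Proof. by case: chi_char. Qed.

Lemma chiX a k : chi (a ^+ k) = chi a ^+ k.
Proof. by elim: k => [|k IHk]; rewrite ?expr0 ?exprS ?chiM ?IHk. Qed.

Lemma chi_neq0 a : a != 0 -> chi a != 0.
Proof.
move=> a0; apply/eqP => ca0; have := chiM a a^-1.
by rewrite ca0 mul0r divff // chi1; apply/eqP/oner_neq0.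
Qed.

(** [T] is an upper bound for the length of the signed sum, hence [ssumW]. *)
Inductive ssum (S : F -> Prop) : nat -> K -> Prop :=
| ssum0 : ssum S 0 0
| ssumW T c of ssum S T c : ssum S T.+1 c
| ssumD T c a of ssum S T c & S a : ssum S T.+1 (c + chi a)
| ssumB T c a of ssum S T c & S a : ssum S T.+1 (c - chi a).

Definition sgen S c := exists T, ssum S T c.

Definition mgroup (S : F -> Prop) :=
  [/\ S 1, forall a b, S a -> S b -> S (a * b), forall a, S a -> S a^-1
    & forall a, S a -> a != 0].

Definition mul_nonzero (a : F) : Prop := a != 0.

Lemma mgroup_nonzero : mgroup mul_nonzero.
Proof.
split=> [|a b|a|//]; rewrite /mul_nonzero ?oner_neq0 ?invr_eq0 //.
exact: mulf_neq0.
Qed.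

Lemma mgroupX S a k : mgroup S -> S a -> S (a ^+ k).
Proof.
case=> S1 SM _ _ Sa; elim: k => [|k IHk]; first by rewrite expr0.
by rewrite exprS; apply: SM.
Qed.

Section Sums.
Variable S : F -> Prop.

Lemma ssum_le T T' c : (T <= T')%N -> ssum S T c -> ssum S T' c.
Proof.
move=> /subnK <-; elim: (T' - T)%N => //= k IHk Sc.
by rewrite addSn; apply: ssumW; apply: IHk.
Qed.

Lemma ssum_zero T : ssum S T 0.
Proof. exact: ssum_le (leq0n _) (ssum0 S). Qed.

(** Lengths add under sums and multiply under products, like l1-norms in a group
ring. *)
Lemma ssum_add T T' c c' : ssum S T c -> ssum S T' c' -> ssum S (T + T') (c + c').
Proof.
move=> Sc; elim=> [|U d _ IH|U d a _ IH Sa|U d a _ IH Sa]; rewrite ?addnS.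
- by rewrite addn0 addr0.
- exact: ssumW.
- by rewrite addrA; apply: ssumD.
- by rewrite addrA; apply: ssumB.
Qed.

Lemma ssum_muln n T c : ssum S T c -> ssum S (n * T) (c *+ n).
Proof.
move=> Sc; elim: n => [|n IHn]; first by rewrite mulr0n; apply: ssum0.
by rewrite mulrS mulSn; apply: ssum_add.
Qed.

Lemma ssum_opp T c : ssum S T c -> ssum S T (- c).
Proof.
elim=> [|U d _ IH|U d a _ IH Sa|U d a _ IH Sa].
- by rewrite oppr0; apply: ssum0.
- exact: ssumW.
- by rewrite opprD; apply: ssumB.
- by rewrite opprB addrC; apply: ssumD.
Qed.

Lemma ssum_chi a : S a -> ssum S 1 (chi a).
Proof. by move=> Sa; rewrite -[chi a]add0r; apply: ssumD => //; apply: ssum0. Qed.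

Lemma ssum_sum n T (c : nat -> K) :
  (forall i, (i < n)%N -> ssum S T (c i)) -> ssum S (n * T) (\sum_(i < n) c i).
Proof.
elim: n => [|n IHn] Sc; first by rewrite big_ord0; apply: ssum0.
rewrite big_ord_recr /= mulSn addnC; apply: ssum_add; last exact: Sc.
by apply: IHn => i lti; apply: Sc; apply: ltnW.
Qed.

Hypothesis grpS : mgroup S.

Lemma ssum_mul_chi T c a : ssum S T c -> S a -> ssum S T (c * chi a).
Proof.
case: grpS => _ SM _ _ Sc Sa; elim: Sc => [|U d _ IH|U d b _ IH Sb|U d b _ IH Sb].
- by rewrite mul0r; apply: ssum0.
- exact: ssumW.
- by rewrite mulrDl -chiM; apply: ssumD => //; apply: SM.
- by rewrite mulrBl -chiM; apply: ssumB => //; apply: SM.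
Qed.

Lemma ssum_mul T T' c c' : ssum S T c -> ssum S T' c' -> ssum S (T * T') (c * c').
Proof.
move=> Sc; elim=> [|U d _ IH|U d a _ IH Sa|U d a _ IH Sa]; rewrite ?mulnS.
- by rewrite muln0 mulr0; apply: ssum0.
- by apply: ssum_le IH; apply: leq_addl.
- by rewrite mulrDr addnC; apply: ssum_add => //; apply: ssum_mul_chi.
- by rewrite mulrBr addnC; apply: ssum_add => //; apply/ssum_opp/ssum_mul_chi.
Qed.

Lemma ssum_exp T c k : ssum S T c -> ssum S (T ^ k) (c ^+ k).
Proof.
move=> Sc; elim: k => [|k IHk].
  by rewrite expr0 expn0 -chi1; apply: ssum_chi; case: grpS.
by rewrite exprS expnS; apply: ssum_mul.
Qed.

Lemma sgen0 : sgen S 0. Proof. by exists 0; apply: ssum0. Qed.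
Lemma sgen1 : sgen S 1.
Proof. by exists 1%N; rewrite -chi1; apply: ssum_chi; case: grpS. Qed.
Lemma sgenB c d : sgen S c -> sgen S d -> sgen S (c - d).
Proof. by move=> [T Sc] [U Sd]; exists (T + U)%N; apply/ssum_add/ssum_opp. Qed.
Lemma sgenM c d : sgen S c -> sgen S d -> sgen S (c * d).
Proof. by move=> [T Sc] [U Sd]; exists (T * U)%N; apply: ssum_mul. Qed.
Lemma sgenD c d : sgen S c -> sgen S d -> sgen S (c + d).
Proof. by move=> [T Sc] [U Sd]; exists (T + U)%N; apply: ssum_add. Qed.
Lemma sgen_nat k : sgen S k%:R.
Proof.
by exists (k * 1)%N; apply: ssum_muln; rewrite -chi1; apply: ssum_chi; case: grpS.
Qed.
Lemma sgenX c k : sgen S c -> sgen S (c ^+ k).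
Proof. by move=> [T Sc]; exists (T ^ k)%N; apply: ssum_exp. Qed.

End Sums.

Section Span.
Variable D : K -> Prop.
Hypotheses (D1 : D 1) (DB : forall c d, D c -> D d -> D (c - d))
  (DM : forall c d, D c -> D d -> D (c * d)).

Definition indep s (e : nat -> K) := forall c : nat -> K,
  (forall l, D (c l)) -> \sum_(l < s) c l * e l = 0 -> forall l, (l < s)%N -> c l = 0.

Let D0 : D 0. Proof. by rewrite -(subrr 1); apply: DB. Qed.

(** Go through [zs]: either the next element satisfies a nontrivial relation over the
current free family, and [delta] absorbs its denominator, or it joins the
family. *)
Lemma free_span (zs : seq K) : exists delta s e,
  [/\ D delta, delta != 0, indep s e
    & forall z, z \in zs -> exists A : nat -> K,
        (forall l, D (A l)) /\ delta * z = \sum_(l < s) A l * e l].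
Proof.
elim: zs => [|z zs [delta [s [e [Dd d0 ind Hz]]]]].
  by exists 1, 0%N, (fun=> 0); split=> //; rewrite oner_neq0.
have [[mu [Dmu mu0 [c [Dc muz]]]]|nrel] := EM (exists mu, [/\ D mu, mu != 0
   & exists c : nat -> K, (forall l, D (c l)) /\ mu * z = \sum_(l < s) c l * e l]).
  exists (delta * mu), s, e; split=> //; [exact: DM|exact: mulf_neq0|].
  move=> z'; rewrite inE => /predU1P[->|/Hz[A [DA Az]]].
    exists (fun l => delta * c l); split=> [l|]; first exact: DM.
    by rewrite -mulrA muz mulr_sumr; apply: eq_bigr => l _; rewrite mulrA.
  exists (fun l => mu * A l); split=> [l|]; first exact: DM.
  rewrite mulrAC Az mulrC mulr_sumr.
  by apply: eq_bigr => l _; rewrite mulrA.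
exists delta, s.+1, (fun l => if l == s then z else e l); split=> //.
  move=> c Dc; rewrite big_ord_recr /= eqxx => rel.
  have rel' : c s * z = \sum_(l < s) (0 - c l) * e l.
    have -> : \sum_(l < s) (0 - c l) * e l =
        - \sum_(l < s) c l * (if (l : nat) == s then z else e l).
      by rewrite -sumrN; apply: eq_bigr => l _; rewrite ltn_eqF // sub0r mulNr.
    by apply/eqP; rewrite -addr_eq0 addrC rel.
  have cs0 : c s = 0.
    apply/eqP; apply: contrapT => /negP cs0; apply: nrel.
    exists (c s); split=> //; exists (fun l => 0 - c l); split=> // l.
    exact: DB.
  move=> l; rewrite ltnS leq_eqVlt => /predU1P[->//|lts].
  apply: (ind c) => //.
  rewrite -[RHS]rel cs0 mul0r addr0; apply: eq_bigr => i _.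
  by rewrite ltn_eqF.
move=> z'; rewrite inE => /predU1P[->|/Hz[A [DA Az]]].
  exists (fun l => if l == s then delta else 0); split=> [l|].
    by case: ifP.
  rewrite big_ord_recr /= eqxx big1 ?add0r // => i _.
  by rewrite ltn_eqF // mul0r.
exists (fun l => if l == s then 0 else A l); split=> [l|].
  by case: ifP.
rewrite big_ord_recr /= eqxx mul0r addr0 Az.
by apply: eq_bigr => i _; rewrite ltn_eqF.
Qed.

End Span.

Lemma bounded_coords S s (A : nat -> K) : (forall l, sgen S (A l)) ->
  exists B, forall l, (l < s)%N -> ssum S B (A l).
Proof.
move=> SA; elim: s => [|s [B HB]]; first by exists 0%N.
have [T HT] := SA s.
exists (B + T)%N => l; rewrite ltnS leq_eqVlt => /predU1P[->|/HB].
  by apply: ssum_le HT; apply: leq_addl.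
by apply: ssum_le; apply: leq_addr.
Qed.

(** The same with coordinates of bounded length, which is what length estimates
need. *)
Lemma free_span_ssum S (zs : seq K) : mgroup S -> exists delta s e B,
  [/\ sgen S delta, delta != 0, indep (sgen S) s e
    & forall z, z \in zs -> exists A : nat -> K,
        (forall l, ssum S B (A l)) /\ delta * z = \sum_(l < s) A l * e l].
Proof.
move=> grpS.
have [delta [s [e [Sd d0 ind Hz]]]] :=
  free_span (sgen1 grpS) (@sgenB S) (sgenM grpS) zs.
exists delta, s, e.
suff [B HB] : exists B, forall z, z \in zs -> exists A : nat -> K,
    (forall l, ssum S B (A l)) /\ delta * z = \sum_(l < s) A l * e l.
  by exists B.
elim: zs Hz => [|z zs IH] Hz; first by exists 0%N.
have [|B HB] := IH; first by move=> w wzs; apply: Hz; rewrite inE wzs orbT.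
have [A [SA Az]] := Hz z (mem_head _ _).
have [T HT] := bounded_coords s SA.
exists (B + T)%N => w; rewrite inE => /predU1P[->|/HB[A' [SA' Aw]]].
  exists (fun l => if (l < s)%N then A l else 0); split=> [l|].
    case: ifP => [/HT|_]; last exact: ssum_zero.
    by apply: ssum_le; apply: leq_addl.
  by rewrite Az; apply: eq_bigr => l _; rewrite ltn_ord.
by exists A'; split=> // l; apply: ssum_le (SA' l); apply: leq_addr.
Qed.

Definition not_divisible S := forall T N c e,
  ssum S T c -> sgen S e -> (T < N)%N -> c = e *+ N -> c = 0.

Definition adjoin (S : F -> Prop) a : F -> Prop :=
  fun x => exists s i, S s /\ x = s * a ^+ i.

Lemma mgroup_adjoin S a m : mgroup S -> a != 0 -> (0 < m)%N -> S (a ^+ m) ->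
  mgroup (adjoin S a).
Proof.
move=> grpS a0 m0 Sam; case: (grpS) => S1 SM SV S0; split.
- by exists 1, 0%N; rewrite expr0 mulr1.
- move=> _ _ [s [i [Ss ->]]] [t [j [St ->]]]; exists (s * t), (i + j)%N.
  by split; [exact: SM|rewrite exprD mulrACA].
- move=> _ [s [i [Ss ->]]]; exists (s^-1 * (a ^+ m ^+ i)^-1), (m.-1 * i)%N.
  split; first by apply: (SM); apply: SV => //; apply: mgroupX.
  rewrite invfM -mulrA; congr (_ * _).
  apply: (@mulfI _ (a ^+ (m * i))); first by rewrite expf_neq0.
  rewrite -exprM mulVKf ?expf_neq0 //.
  rewrite -{1}(prednK m0) mulSn addnC exprD -mulrA divff ?expf_neq0 //.
  by rewrite mulr1.
- by move=> _ [s [i [Ss ->]]]; rewrite mulf_neq0 ?expf_neq0 //; apply: S0.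
Qed.

(** Bernoulli: [(T+1)^k] outgrows [T^k B]. *)
Lemma expn_gap T N B : (T < N)%N -> exists k, (T ^ k * B < N ^ k)%N.
Proof.
move=> TN; have [->|T0] := posnP T.
  by exists 1%N; rewrite expn1 mul0n expn1; lia.
have gap k : (T ^ k * (T + k) <= T * T.+1 ^ k)%N.
  elim: k => [|k IHk]; first by rewrite !expn0; lia.
  rewrite !expnS; nia.
exists (T * B).+1; set k := (T * B).+1.
have := gap k; have : (0 < T ^ k)%N by rewrite expn_gt0 T0.
have : (T.+1 ^ k <= N ^ k)%N by rewrite leq_exp2r.
rewrite /k; nia.
Qed.

(** Compare coordinates over the free family spanning the extension.  A factor [B] is
lost in passing to coordinates, so the hypothesis on [S] cannot be applied to
[c = N e] itself; but the same factor [B] is lost for every power [c^k = N^k e^k],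
and is beaten by [(N/T)^k]. *)
Lemma not_divisible_adjoin S a m : mgroup S -> a != 0 -> (0 < m)%N ->
  S (a ^+ m) -> not_divisible S -> not_divisible (adjoin S a).
Proof.
move=> grpS a0 m0 Sam ndS T N c e Sc [E Se] TN ceN.
have grpS' := mgroup_adjoin grpS a0 m0 Sam.
have [S1 SM SV S0] := grpS.
have [delta [s [z [B [Sd d0 ind Hz]]]]] :=
  free_span_ssum [seq chi a ^+ i | i <- iota 0 m] grpS.
(* Modulo S, only the powers of a below m matter. *)
have Hchi b : adjoin S a b -> exists A : nat -> K, (forall l, ssum S B (A l)) /\
    delta * chi b = \sum_(l < s) A l * z l.
  case=> t [i [St ->]].
  have [A [SA Ai]] : exists A : nat -> K, (forall l, ssum S B (A l)) /\
      delta * chi a ^+ (i %% m) = \sum_(l < s) A l * z l.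
    by apply: Hz; apply/mapP; exists (i %% m)%N; rewrite // mem_iota ltn_mod m0.
  pose u := t * a ^+ m ^+ (i %/ m).
  have Su : S u by apply: (SM) => //; apply: mgroupX.
  exists (fun l => A l * chi u); split=> [l|]; first exact: ssum_mul_chi.
  have -> : t * a ^+ i = a ^+ (i %% m) * u.
    by rewrite /u mulrCA -exprM -exprD addnC mulnC -divn_eq.
  rewrite chiM chiX mulrA Ai mulr_suml.
  by apply: eq_bigr => l _; rewrite mulrAC.
have coords U u : ssum (adjoin S a) U u -> exists phi : nat -> K,
    (forall l, ssum S (U * B) (phi l)) /\ delta * u = \sum_(l < s) phi l * z l.
  elim=> [|V d _ [phi [Sphi IH]]|V d b _ [phi [Sphi IH]] /Hchi[A [SA Ab]]
         |V d b _ [phi [Sphi IH]] /Hchi[A [SA Ab]]].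
  - exists (fun=> 0); split=> [l|]; first exact: ssum0.
    by rewrite mulr0 big1 // => l _; rewrite mul0r.
  - exists phi; split=> // l; apply: ssum_le (Sphi l).
    by rewrite mulSn leq_addl.
  - exists (fun l => phi l + A l); split=> [l|].
      by rewrite mulSn addnC; apply: ssum_add.
    by rewrite mulrDr IH Ab -big_split; apply: eq_bigr => l _; rewrite mulrDl.
  - exists (fun l => phi l - A l); split=> [l|].
      by rewrite mulSn addnC; apply/ssum_add/ssum_opp.
    rewrite mulrBr IH Ab -sumrB; apply: eq_bigr => l _.
    by rewrite mulrBl.
have [k Hk] := expn_gap B TN.
have [phi [Sphi phiE]] := coords _ _ (ssum_exp grpS' k Sc).
have [psi [Spsi psiE]] := coords _ _ (ssum_exp grpS' k Se).
have phi0 l : (l < s)%N -> phi l = 0.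
  move=> lts.
  have : phi l - psi l *+ N ^ k = 0.
    apply: (ind (fun l => phi l - psi l *+ N ^ k)) => // [j|].
      apply: sgenB; first by exists (T ^ k * B)%N.
      by exists (N ^ k * (E ^ k * B))%N; apply: ssum_muln.
    transitivity (delta * c ^+ k - (delta * e ^+ k) *+ N ^ k).
      rewrite phiE psiE -sumrMnl -sumrB; apply: eq_bigr => i _.
      by rewrite mulrBl mulrnAl.
    by rewrite ceN exprMn_n mulrnAr subrr.
  move=> /eqP; rewrite subr_eq0 => /eqP.
  by apply: ndS Hk => //; exists (E ^ k * B)%N.
have : delta * c ^+ k = 0 by rewrite phiE big1 // => l _; rewrite phi0 ?mul0r.
by move=> /eqP; rewrite mulf_eq0 (negPf d0) expf_eq0 => /andP[_ /eqP].
Qed.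

End SignedSums.

(** * Integers are generic up to bounded complexity *)

Section Generic.
Local Open Scope ring_scope.
Variables (F : fieldType) (K : idomainType) (chi : F -> K).
Hypothesis chi_gen : generic_character chi.
Hypothesis K_char0 : has_char 0 K.

Let chi_char : character chi. Proof. by case: chi_gen. Qed.

Lemma natf_eq0 (k : nat) : (k%:R == 0 :> K) = (k == 0%N).
Proof. exact: (pcharf0P K).1 K_char0 k. Qed.

Lemma mulrn_eq0 (c : K) k : (c *+ k == 0) = (k == 0%N) || (c == 0).
Proof. by rewrite -mulr_natl mulf_eq0 natf_eq0. Qed.

Lemma prime_field_int (E : fieldType) (z : int) : prime_field E z%:~R.
Proof.
move=> S [S1 SB _].
have S0 : 0 \in S by rewrite -(subrr 1); apply: SB.
have Sn k : k%:R \in S.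
  elim: k => // k IHk; rewrite -[k.+1]addn1 natrD -[1%:R]opprK.
  by apply: (SB) => //; rewrite -sub0r; apply: SB.
case: z => k; first exact: Sn.
by rewrite NegzE mulrNz -sub0r; apply: SB => //; apply: Sn.
Qed.

Section Free.
Variables (n : nat) (I : n.-tuple F).
Hypothesis I_neq0 : forall i, tnth I i != 0.
Hypothesis I_indep : ~ mul_dependent I.

Local Notation eval_chi := (mmap (intr : int -> K) (chi \o tnth I)).

(** Genericity speaks of the fraction field and its prime field; this moves integer
polynomials there. *)
Lemma tofrac_eval_chi P : tofrac (eval_chi P) =
  (map_mpoly (intr : int -> {fraction K}) P).@[
     tnth (map_tuple (fun b => tofrac (chi b)) I)].
Proof.
set P' := map_mpoly _ P; pose k := maxn (mmeasure mdeg P) (mmeasure mdeg P').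
rewrite /meval (mmapE k) ?leq_maxl // (mmapE k) ?leq_maxr //.
rewrite rmorph_sum; apply: eq_bigr => m _.
rewrite rmorphM rmorph_int mcoeff_map_mpoly /= rmorph_prod; congr (_ * _).
by apply: eq_bigr => i _; rewrite rmorphXn tnth_map.
Qed.

Lemma fracz_inj : injective (intr : int -> {fraction K}).
Proof.
move=> y z /eqP; rewrite -subr_eq0 -rmorphB /= => yz; apply/eqP.
rewrite -subr_eq0; move: (y - z) yz => {}y.
have nz k : (k%:R == 0 :> {fraction K}) = (k == 0%N).
  by rewrite -(rmorph_nat (@tofrac K)) tofrac_eq0 natf_eq0.
case: y => k; first by rewrite nz.
by rewrite NegzE mulrNz oppr_eq0 nz.
Qed.

Lemma eval_chi_inj P : eval_chi P = 0 -> P = 0.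
Proof.
move=> P0; have [n0|n_gt0] := posnP n.
  have PC : P = (P@_0)%:MP.
    apply/mpolyP => m; rewrite mcoeffC.
    suff -> : m = 0%MM by rewrite eqxx mulr1.
    by apply/mnmP => i; case: i => i lti; exfalso; rewrite n0 in lti.
  move: P0; rewrite PC mmapC => /(congr1 (@tofrac K)).
  rewrite rmorph_int rmorph0 => P0; congr (_%:MP).
  by apply: fracz_inj; rewrite P0.
case: chi_gen => _ _ /(_ n I n_gt0 I_indep) algI.
have : map_mpoly (intr : int -> {fraction K}) P = 0.
  apply: algI; last by rewrite -tofrac_eval_chi P0 rmorph0.
  by move=> m; rewrite mcoeff_map_mpoly; apply: prime_field_int.
move=> P'0; apply/mpolyP => m; apply: fracz_inj.
by rewrite -(mcoeff_map_mpoly (intr : int -> {fraction K})) P'0 !mcoeff0.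
Qed.

Lemma eval_chiX (k : n.-tuple nat) : eval_chi 'X_[Multinom k] = chi (tuple_exp I k).
Proof.
case: (chi_char) => chiM _ chi1.
rewrite mmapX /mmap1 /tuple_exp (big_morph chi chiM chi1).
by apply: eq_bigr => i _; rewrite /= (chiX chi_char).
Qed.

Lemma tuple_exp_neq0 (k : n.-tuple nat) : tuple_exp I k != 0.
Proof. by apply/prodf_neq0 => i _; rewrite expf_neq0. Qed.

Definition tuple_add (k l : n.-tuple nat) : n.-tuple nat :=
  mktuple (fun i => tnth k i + tnth l i)%N.

Lemma tuple_expD k l : tuple_exp I (tuple_add k l) = tuple_exp I k * tuple_exp I l.
Proof.
rewrite /tuple_exp -big_split; apply: eq_bigr => i _.
by rewrite tnth_mktuple exprD.
Qed.

(** The subgroup generated by the entries of [I], written with natural exponents on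
both sides. *)
Definition subgroup_of (x : F) : Prop :=
  x != 0 /\ exists u v : n.-tuple nat, x * tuple_exp I u = tuple_exp I v.

Lemma mgroup_subgroup_of : mgroup subgroup_of.
Proof.
split.
- split; first exact: oner_neq0.
  by exists (nseq_tuple n 0), (nseq_tuple n 0); rewrite mul1r.
- move=> x y [x0 [u [v xuv]]] [y0 [u' [v' yuv]]]; split; first exact: mulf_neq0.
  exists (tuple_add u u'), (tuple_add v v'); rewrite !tuple_expD.
  by rewrite mulrACA xuv yuv.
- move=> x [x0 [u [v xuv]]]; split; first by rewrite invr_eq0.
  by exists v, u; rewrite -xuv mulKf.
- by move=> x [].
Qed.

(** After multiplication by a monomial that clears negative exponents, a signed sum of
length [T] is the value of a polynomial whose coefficients are at most [T]. *)
Lemma ssum_eval T c : ssum chi subgroup_of T c ->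
  exists w P, c * chi (tuple_exp I w) = eval_chi P /\
              forall m, (`|P@_m|%N <= T)%N.
Proof.
case: (chi_char) => chiM _ _.
have step U d a (eps : int) : (`|eps| <= 1)%N -> subgroup_of a ->
    (exists w P, d * chi (tuple_exp I w) = eval_chi P /\
              forall m, (`|P@_m|%N <= U)%N) ->
    exists w P, (d + chi a *~ eps) * chi (tuple_exp I w) = eval_chi P /\
              forall m, (`|P@_m|%N <= U.+1)%N.
  move=> le_eps [_ [u [v auv]]] [w [P [dP leP]]].
  exists (tuple_add w u), (P * 'X_[Multinom u] + 'X_[Multinom (tuple_add v w)] *~ eps).
  split.
    rewrite rmorphD rmorphM rmorphMz /= !eval_chiX !tuple_expD !chiM -dP -auv chiM.
    ring.
  move=> m; rewrite mcoeffD.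
  have leX : (`|('X_[Multinom (tuple_add v w)] *~ eps)@_m : int| <= 1)%N.
    rewrite raddfMz /= mcoeffX; case: (_ == m) => /=; rewrite ?mul0rz //.
    by rewrite -mulrzl mulr1 intz.
  have leP' : (`|(P * 'X_[Multinom u])@_m : int| <= U)%N.
    have [[k ->]|nle] := EM (exists k, m = Multinom u + k)%MM.
      by rewrite mcoeffMX.
    rewrite mcoeffM big1 // => k /eqP mk.
    rewrite mcoeffX; case: eqP => [uk|_]; last by rewrite mulr0.
    by case: nle; exists k.1; rewrite uk addmC.
  by move: leX leP'; lia.
elim=> [|U d _ [w [P [dP leP]]]|U d a _ IH Ga|U d a _ IH Ga].
- exists (nseq_tuple n 0), 0; split; first by rewrite mul0r rmorph0.
  by move=> m; rewrite mcoeff0.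
- by exists w, P; split=> // m; rewrite leqW.
- by have := step U d a 1 isT Ga IH; rewrite mulr1z.
- by have := step U d a (-1) isT Ga IH; rewrite mulrN1z.
Qed.

(** Evaluation at [chi (I)] is injective on integer polynomials, so divisibility by [N]
can be tested on coefficients. *)
Lemma not_divisible_free : not_divisible chi subgroup_of.
Proof.
case: (chi_char) => chiM _ _.
move=> T N c e /ssum_eval[w [P [cP leP]]] [E /ssum_eval[w' [Q [eQ _]]]] TN ceN.
have PQ : P * 'X_[Multinom w'] = (Q * 'X_[Multinom w]) *+ N.
  apply/eqP; rewrite -subr_eq0; apply/eqP; apply: eval_chi_inj.
  rewrite rmorphB rmorphMn !rmorphM /= !eval_chiX -cP -eQ ceN.
  by rewrite mulrAC !mulrnAl subrr.
have P0 : P = 0.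
  apply/mpolyP => m; rewrite mcoeff0.
  have := congr1 (mcoeff (Multinom w' + m)%MM) PQ.
  rewrite mcoeffMX mcoeffMn; move: (leP m).
  move: (P@_m) ((Q * _)@_ _) => p q lep; rewrite -mulr_natr natz => pq.
  have : `|p|%N = (`|q| * N)%N by rewrite pq abszM.
  have [->|q0] := eqVneq q 0; first by lia.
  have : (0 < `|q|)%N by rewrite absz_gt0.
  by nia.
apply/eqP; move: cP; rewrite P0 rmorph0 => /eqP.
by rewrite mulf_eq0 (negPf (chi_neq0 chi_char (tuple_exp_neq0 w))) orbF.
Qed.

End Free.

(** A maximal independent subfamily of [l], chosen greedily: an element no power of
which lies in the current subgroup can be added without creating a relation. *)
Lemma max_mul_indep (l : seq F) : (forall a, a \in l -> a != 0) ->
  exists n (I : n.-tuple F),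
    [/\ forall i, tnth I i != 0, ~ mul_dependent I
      & forall a, a \in l -> exists m, (0 < m)%N /\ subgroup_of I (a ^+ m)].
Proof.
elim: l => [|a l IHl] l0.
  exists 0%N, [tuple]; split=> [[]//||//].
  by case=> k [k' [kk' _]]; apply: kk'; rewrite (tuple0 k) (tuple0 k').
have [|n [I [I0 indI Hl]]] := IHl.
  by move=> b bl; apply: l0; rewrite inE bl orbT.
have a0 : a != 0 by apply: l0; rewrite mem_head.
have [Ha|Ha] := EM (exists m, (0 < m)%N /\ subgroup_of I (a ^+ m)).
  by exists n, I; split=> // b; rewrite inE => /predU1P[->|/Hl].
have expC d (k : n.-tuple nat) :
    tuple_exp (cons_tuple a I) [tuple of d :: k] = a ^+ d * tuple_exp I k.
  rewrite /tuple_exp big_ord_recl !tnth0; congr (_ * _).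
  by apply: eq_bigr => i _; rewrite !tnthS.
have expE (k : n.+1.-tuple nat) :
    tuple_exp (cons_tuple a I) k = a ^+ thead k * tuple_exp I [tuple of behead k].
  by rewrite {1}[k]tuple_eta expC.
exists n.+1, (cons_tuple a I); split.
- by move=> i; case: (unliftP ord0 i) => [j ->|->]; rewrite ?tnthS.
- have indep_lt k k' : (thead k < thead k')%N ->
      tuple_exp (cons_tuple a I) k <> tuple_exp (cons_tuple a I) k'.
    move=> ltk; rewrite !expE => e; apply: Ha.
    exists (thead k' - thead k)%N; split; first by rewrite subn_gt0.
    split; first exact: expf_neq0.
    exists [tuple of behead k'], [tuple of behead k].
    apply: (@mulfI _ (a ^+ thead k)); first exact: expf_neq0.
    by rewrite e mulrA -exprD subnKC // ltnW.
  case=> k [k' [kk' e]].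
  case: (ltngtP (thead k) (thead k')) => [/indep_lt|/indep_lt /(_ (esym e))|ek] //.
  apply: indI; exists [tuple of behead k], [tuple of behead k']; split.
    move=> eb; apply: kk'; rewrite [k]tuple_eta [k']tuple_eta ek.
    have ebs : behead k = behead k' by exact: (congr1 val eb).
    by apply: val_inj; rewrite /= ebs.
  move: e; rewrite !expE ek; apply: mulfI; exact: expf_neq0.
- move=> b; rewrite inE => /predU1P[->|/Hl[m [m0 [bm [u [v buv]]]]]].
    exists 1%N; split=> //; split; first exact: expf_neq0.
    exists [tuple of 0%N :: nseq_tuple n 0%N], [tuple of 1%N :: nseq_tuple n 0%N].
    by rewrite !expC expr0 mul1r !expr1.
  exists m; split=> //; split=> //.
  exists [tuple of 0%N :: u], [tuple of 0%N :: v].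
  by rewrite !expC expr0 !mul1r.
Qed.

(** Only finitely many elements occur in [c] and [e]; start from a maximal independent
subfamily and adjoin the others, which are torsion over it, one by one. *)
Lemma not_divisible_nonzero : not_divisible chi (@mul_nonzero F).
Proof.
have grp_of (l : seq F) : (forall a, a \in l -> a != 0) -> exists S : F -> Prop,
    [/\ mgroup S, not_divisible chi S & forall a, a \in l -> S a].
  move=> l0; have [n [I [I0 indI HI]]] := max_mul_indep l0.
  suff [S [grpS ndS _ Sl]] : exists S : F -> Prop, [/\ mgroup S,
      not_divisible chi S, forall a, subgroup_of I a -> S a
      & forall a, a \in l -> S a] by exists S.
  elim: l l0 HI => [|a l IHl] l0 HI.
    exists (subgroup_of I); split=> //; first exact: mgroup_subgroup_of.
    exact: not_divisible_free.
  have [||S [grpS ndS IS Sl]] := IHl.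
  - by move=> b bl; apply: l0; rewrite inE bl orbT.
  - by move=> b bl; apply: HI; rewrite inE bl orbT.
  have [m [m0 /IS Sam]] := HI a (mem_head _ _).
  have a0 := l0 a (mem_head _ _).
  have SS' b : S b -> adjoin S a b.
    by move=> Sb; exists b, 0%N; rewrite expr0 mulr1.
  exists (adjoin S a); split.
  - exact: mgroup_adjoin Sam.
  - exact: not_divisible_adjoin Sam ndS.
  - by move=> b /IS/SS'.
  - move=> b; rewrite inE => /predU1P[->|/Sl/SS'//].
    by exists 1, 1%N; rewrite expr1 mul1r; case: grpS.
have support T c : ssum chi (@mul_nonzero F) T c ->
    exists2 l : seq F, forall a, a \in l -> a != 0
      & forall S, (forall a, a \in l -> S a) -> ssum chi S T c.
  elim=> [|U d _ [l l0 Hl]|U d a _ [l l0 Hl] a0|U d a _ [l l0 Hl] a0].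
  - by exists [::] => // S _; apply: ssum0.
  - by exists l => // S /Hl; apply: ssumW.
  - exists (a :: l) => [b|S HS]; first by rewrite inE => /predU1P[->|/l0].
    apply: ssumD; last by apply: HS; rewrite mem_head.
    by apply: Hl => b bl; apply: HS; rewrite inE bl orbT.
  - exists (a :: l) => [b|S HS]; first by rewrite inE => /predU1P[->|/l0].
    apply: ssumB; last by apply: HS; rewrite mem_head.
    by apply: Hl => b bl; apply: HS; rewrite inE bl orbT.
move=> T N c e /support[l l0 Hl] [E /support[l' l0' Hl']] TN ceN.
have [|S [grpS ndS HS]] := grp_of (l ++ l').
  by move=> a; rewrite mem_cat => /orP[/l0|/l0'].
apply: ndS (Hl S _) _ TN ceN.
  by move=> a al; apply: HS; rewrite mem_cat al.
by exists E; apply: Hl' => a al; apply: HS; rewrite mem_cat al orbT.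
Qed.

(** The digits of an expansion in base [N] that are short relative to [N] vanish with
the sum: the lowest digit is a multiple of [N]. *)
Lemma horner_nat_eq0 U N d (w : nat -> K) :
  (forall j, ssum chi (@mul_nonzero F) U (w j)) -> (U < N)%N ->
  \sum_(j < d) w j * N%:R ^+ j = 0 -> forall j, (j < d)%N -> w j = 0.
Proof.
move=> Sw UN; elim: d w Sw => // d IHd w Sw.
rewrite big_ord_recl expr0 mulr1 => w0.
have shift : \sum_(i < d) w (lift ord0 i) * N%:R ^+ lift ord0 i =
    (\sum_(i < d) w i.+1 * N%:R ^+ i) *+ N.
  rewrite -sumrMnl; apply: eq_bigr => i _.
  by rewrite lift0 exprS mulrCA mulr_natl.
move: w0; rewrite shift => w0.
have w00 : w 0%N = 0.
  apply: (not_divisible_nonzero (Sw 0%N) _ UN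
     (e := - \sum_(i < d) w i.+1 * N%:R ^+ i)).
    have grp := mgroup_nonzero F.
    rewrite -sub0r; apply: sgenB; first exact: sgen0.
    apply: (big_ind (sgen chi (@mul_nonzero F))) => [||i _].
    - exact: sgen0.
    - exact: sgenD.
    - apply: sgenM => //; first by exists U.
      by apply: sgenX => //; apply: sgen_nat.
  by apply/eqP; rewrite mulNrn -addr_eq0 w0.
case=> [_ //|j ltj]; apply: (IHd (fun j => w j.+1)) => //.
apply/eqP; move: w0; rewrite w00 add0r => /eqP; rewrite mulrn_eq0.
by case/predU1P => [N0|//]; rewrite N0 in UN.
Qed.

(** One integer serves all choices of short coefficients [c].  The coefficients of the
fixed polynomials [z i] are expanded over a free family, so that the claim reduces
to [horner_nat_eq0] in each coordinate. *)
Lemma small_integer N T (z : 'I_N -> {poly K}) : exists n : nat,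
  forall c : 'I_N -> K, (forall i, ssum chi (@mul_nonzero F) T (c i)) ->
    (\sum_i c i *: z i).[n%:R] = 0 -> \sum_i c i *: z i = 0.
Proof.
pose d := \max_i size (z i).
have sz_z i : (size (z i) <= d)%N by apply: leq_bigmax.
have grp := mgroup_nonzero F.
have [delta [s [e [B [Sd d0 ind Hz]]]]] := free_span_ssum chi_char
  [seq (z i)`_j | i <- enum 'I_N, j <- iota 0 d] grp.
have /choice[A HA] (ij : 'I_N * nat) : exists A : nat -> K,
    (forall l, ssum chi (@mul_nonzero F) B (A l)) /\
    delta * (z ij.1)`_ij.2 = \sum_(l < s) A l * e l.
  have [ltj|lej] := ltnP ij.2 d.
    by apply: Hz; apply/allpairsP; exists ij; rewrite mem_enum mem_iota add0n.
  exists (fun=> 0); split=> [l|]; first exact: ssum_zero.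
  rewrite nth_default ?(leq_trans (sz_z _)) // mulr0 big1 // => l _.
  by rewrite mul0r.
exists (N * (T * B)).+1 => c Sc; set Q := \sum_i c i *: z i => Qn0.
pose w l j := \sum_i c i * A (i, j) l.
have QE j : delta * Q`_j = \sum_(l < s) w l j * e l.
  rewrite coef_sum mulr_sumr; under eq_bigr => i _.
    rewrite coefZ mulrCA (HA (i, j)).2 mulr_sumr; over.
  rewrite exchange_big; apply: eq_bigr => l _.
  by rewrite mulr_suml; apply: eq_bigr => i _; rewrite mulrA.
have szQ : (size Q <= d)%N.
  apply: leq_trans (size_sum _ _ _) _; apply/bigmax_leqP => i _.
  exact: leq_trans (size_scale_leq _ _) (sz_z i).
have Sw l j : ssum chi (@mul_nonzero F) (N * (T * B)) (w l j).
  pose f (i : nat) := if insub i is Some i' then c i' * A (i', j) l else 0.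
  have -> : w l j = \sum_(i < N) f i.
    by apply: eq_bigr => i _; rewrite /f valK.
  apply: ssum_sum => i _; rewrite /f; case: insubP => [i' _ _|_].
    by apply: ssum_mul => //; apply: (HA _).1.
  exact: ssum_zero.
have w0 l j : (l < s)%N -> (j < d)%N -> w l j = 0.
  move=> lts; apply: (horner_nat_eq0 (Sw l) (ltnSn _)).
  pose W l := \sum_(j < d) w l j * (N * (T * B)).+1%:R ^+ j.
  apply: (ind W) => // [l'|].
    apply: (big_ind (sgen chi (@mul_nonzero F))) => [||i _].
    - exact: sgen0.
    - exact: sgenD.
    - apply: sgenM => //; first by exists (N * (T * B))%N.
      by apply: sgenX => //; apply: sgen_nat.
  transitivity (delta * Q.[(N * (T * B)).+1%:R]); last by rewrite Qn0 mulr0.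
  rewrite (horner_coef_wide _ szQ) mulr_sumr.
  under [RHS]eq_bigr => i _ do rewrite mulrA QE mulr_suml.
  rewrite exchange_big; apply: eq_bigr => l' _.
  by rewrite mulr_suml; apply: eq_bigr => i _; rewrite mulrAC.
apply/polyP => j; rewrite coef0; have [ltj|lej] := ltnP j d; last first.
  by rewrite nth_default // (leq_trans szQ).
apply/eqP; have /eqP : delta * Q`_j = 0.
  by rewrite QE big1 // => l _; rewrite w0 ?mul0r.
by rewrite mulf_eq0 (negPf d0).
Qed.

End Generic.

(** * Polynomial functions of the variables and of character values *)

Section PolynomialFunctions.
Local Open Scope ring_scope.
Variables (F K : fieldType) (chi : F -> K).
Implicit Types V W T : finType.

Inductive fterm V : ((V -> F) -> F) -> Prop :=
| FVar v : fterm (fun a => a v)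
| FZero : fterm (fun _ => 0)
| FOne : fterm (fun _ => 1)
| FAdd f g of fterm f & fterm g : fterm (fun a => f a + g a)
| FOpp f of fterm f : fterm (fun a => - f a)
| FMul f g of fterm f & fterm g : fterm (fun a => f a * g a).

Inductive pfun V W : ((V -> F) -> (W -> K) -> K) -> Prop :=
| PChi f of fterm f : pfun (fun a _ => chi (f a))
| PVar w : pfun (fun _ x => x w)
| PZero : pfun (fun _ _ => 0)
| POne : pfun (fun _ _ => 1)
| PAdd p q of pfun p & pfun q : pfun (fun a x => p a x + q a x)
| POpp p of pfun p : pfun (fun a x => - p a x)
| PMul p q of pfun p & pfun q : pfun (fun a x => p a x * q a x).

Lemma fterm_subst V T (s : T -> (V -> F) -> F) f :
  (forall t, fterm (s t)) -> fterm f -> fterm (fun a => f (s ^~ a)).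
Proof.
move=> Hs; elim=> [v|||g h _ Hg _ Hh|g _ Hg|g h _ Hg _ Hh].
- exact: Hs.
- exact: FZero.
- exact: FOne.
- exact: FAdd.
- exact: FOpp.
- exact: FMul.
Qed.

Lemma pfun_subst V W V' W' (s : V' -> (V -> F) -> F)
    (u : W' -> (V -> F) -> (W -> K) -> K) p :
  (forall v, fterm (s v)) -> (forall w, pfun (u w)) -> pfun p ->
  pfun (fun a x => p (s ^~ a) (fun w => u w a x)).
Proof.
move=> Hs Hu; elim=> [f Hf|w|||g h _ Hg _ Hh|g _ Hg|g h _ Hg _ Hh].
- by apply: PChi (fterm_subst Hs Hf).
- exact: Hu.
- exact: PZero.
- exact: POne.
- exact: PAdd.
- exact: POpp.
- exact: PMul.
Qed.

Lemma pfun_ren V W V' W' (r : V' -> V) (s : W' -> W) p :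
  pfun p -> pfun (fun a x => p (a \o r) (x \o s)).
Proof.
by apply: (pfun_subst (s := fun v a => a (r v)) (u := fun w _ x => x (s w))) => ?;
  [apply: FVar | apply: PVar].
Qed.

Lemma pfun_coef V W T (s : T -> (V -> F) -> F) (c : (T -> F) -> K) :
  (forall t, fterm (s t)) -> @pfun T void (fun a _ => c a) ->
  @pfun V W (fun a x => c (s ^~ a)).
Proof.
move=> Hs; apply: (@pfun_subst V W T void s (fun w => match w with end)) => //.
Qed.
Arguments pfun_coef {V W T s c}.

Lemma pfun_sum V W (I : finType) (P : pred I) (p : I -> (V -> F) -> (W -> K) -> K) :
  (forall i, pfun (p i)) -> pfun (fun a x => \sum_(i | P i) p i a x).
Proof.
move=> Hp; rewrite (_ : (fun a x => _) = \big[(fun p q a x => p a x + q a x)/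
    (fun _ _ => 0)]_(i | P i) p i).
  apply: big_ind => [|g h Hg Hh|i _]; [exact: PZero|exact: PAdd|exact: Hp].
apply: funext => a; apply: funext => x.
by elim/big_rec2: _ => // i y g _ ->.
Qed.

Lemma fterm_eval V n (f : (V -> F) -> F) : fterm f ->
  exists t : term #|V| n SortF, forall a (x : n.-tuple K),
    f a = eval chi (tuple_of a) x t.
Proof.
elim=> [v|||g h _ [t Ht] _ [u Hu]|g _ [t Ht]|g h _ [t Ht] _ [u Hu]].
- by exists (VarF _ (enum_rank v)) => a x /=; rewrite tnth_mktuple enum_rankK.
- by exists (Zero _ _ SortF).
- by exists (One _ _ SortF).
- by exists (Add t u) => a x /=; rewrite -Ht -Hu.
- by exists (Opp t) => a x /=; rewrite -Ht.
- by exists (Mul t u) => a x /=; rewrite -Ht -Hu.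
Qed.

Lemma pfun_eval V W (p : (V -> F) -> (W -> K) -> K) : pfun p ->
  exists t : term #|V| #|W| SortK, forall a x,
    p a x = eval chi (tuple_of a) (tuple_of x) t.
Proof.
elim=> [f Hf|w|||g h _ [t Ht] _ [u Hu]|g _ [t Ht]|g h _ [t Ht] _ [u Hu]].
- have [t Ht] := fterm_eval #|W| Hf.
  by exists (Chi t) => a x /=; rewrite -Ht.
- by exists (VarK _ (enum_rank w)) => a x /=; rewrite tnth_mktuple enum_rankK.
- by exists (Zero _ _ SortK).
- by exists (One _ _ SortK).
- by exists (Add t u) => a x /=; rewrite -Ht -Hu.
- by exists (Opp t) => a x /=; rewrite -Ht.
- by exists (Mul t u) => a x /=; rewrite -Ht -Hu.
Qed.

Lemma dfn_fterm V W (f g : (V -> F) -> F) : fterm f -> fterm g ->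
  @dfn F K chi V W (fun a _ => f a = g a).
Proof.
move=> /(fterm_eval #|W|)[t Ht] /(fterm_eval #|W|)[u Hu].
by apply: dfn_ext (dfn_term chi t u) => a x; rewrite -Ht -Hu.
Qed.

Lemma dfn_pfun V W (p q : (V -> F) -> (W -> K) -> K) : pfun p -> pfun q ->
  dfn chi (fun a x => p a x = q a x).
Proof.
move=> /pfun_eval[t Ht] /pfun_eval[u Hu].
by apply: dfn_ext (dfn_term chi t u) => a x; rewrite -Ht -Hu.
Qed.

Definition dfnF V (D : (V -> F) -> Prop) : Prop :=
  @dfn F K chi V void (fun a _ => D a).

Lemma dfnF_ren V V' (r : V -> V') D : dfnF D -> @dfnF V' (fun a => D (a \o r)).
Proof. exact: (@dfn_ren F K chi V void V' void r id). Qed.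

(** * Families of algebraic sets indexed by F, and types over F *)

(** A polynomial [q(b, x)] split as a scalar product of a vector depending on [b] and a
vector depending on [x].  This bilinear form is what makes the set of [b] vanishing
at [x] the trace of a linear subspace. *)
Record family W := Family {
  par : finType;
  len : nat;
  coefF : 'I_len -> (par -> F) -> K;
  monK : 'I_len -> (W -> K) -> K;
  coefFP : forall j, @pfun par void (fun b _ => coefF j b);
  monKP : forall j, @pfun void W (fun _ x => monK j x) }.

Definition value W (q : family W) (b : par q -> F) (x : W -> K) : K :=
  \sum_j coefF j b * monK j x.

Lemma pfun_family V W (p : (V -> F) -> (W -> K) -> K) : pfun p ->
  exists n (c : 'I_n -> (V -> F) -> K) (z : 'I_n -> (W -> K) -> K),
    [/\ forall j, @pfun V void (fun a _ => c j a),
        forall j, @pfun void W (fun _ x => z j x)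
      & forall a x, p a x = \sum_j c j a * z j x].
Proof.
move=> Hp; suff [J [c [z [Hc Hz Hcz]]]] : exists (J : finType)
    (c : J -> (V -> F) -> K) (z : J -> (W -> K) -> K),
    [/\ forall j, @pfun V void (fun a _ => c j a),
        forall j, @pfun void W (fun _ x => z j x)
      & forall a x, p a x = \sum_j c j a * z j x].
  exists #|J|, (c \o enum_val), (z \o enum_val); split=> [j|j|a x] /=; try by [].
  by rewrite Hcz (reindex (fun i : 'I_#|J| => enum_val i)) //; apply/onW_bij/enum_val_bij.
elim: Hp => [f Hf|w|||g h _ [J [c [z [Hc Hz Hg]]]] _ [I [d [y [Hd Hy Hh]]]]
  |g _ [J [c [z [Hc Hz Hg]]]]
  |g h _ [J [c [z [Hc Hz Hg]]]] _ [I [d [y [Hd Hy Hh]]]]].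
- exists unit, (fun _ a => chi (f a)), (fun _ _ => 1); split=> [_|_|a x].
  + exact: PChi.
  + exact: POne.
  + by rewrite big_const card_unit /= mulr1 addr0.
- exists unit, (fun _ _ => 1), (fun _ x => x w); split=> [_|_|a x].
  + exact: POne.
  + exact: PVar.
  + by rewrite big_const card_unit /= mul1r addr0.
- exists void, (fun _ _ => 1), (fun _ _ => 1); split=> [[]|[]|a x].
  by rewrite big_pred0 // => -[].
- exists unit, (fun _ _ => 1), (fun _ _ => 1); split=> [_|_|a x].
  + exact: POne.
  + exact: POne.
  + by rewrite big_const card_unit /= mul1r addr0.
- exists (J + I)%type, (fun k a => match k with inl j => c j a | inr i => d i a end),
    (fun k x => match k with inl j => z j x | inr i => y i x end).
  split=> [[j|i]|[j|i]|a x] //.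
  by rewrite Hg Hh big_sumType.
- exists J, (fun j a => - c j a), z; split=> // [j|a x]; first exact: POpp.
  by rewrite Hg -sumrN; apply: eq_bigr => j _; rewrite mulNr.
- exists (J * I)%type, (fun k a => c k.1 a * d k.2 a), (fun k x => z k.1 x * y k.2 x).
  split=> [k|k|a x]; [exact: PMul|exact: PMul|].
  rewrite Hg Hh big_distrlr pair_bigA; apply: eq_bigr => k _.
  by rewrite mulrACA.
Qed.

Lemma pfun_value W (q : family W) V (s : par q -> (V -> F) -> F) :
  (forall t, fterm (s t)) -> pfun (fun a x => value (s ^~ a) x).
Proof.
move=> Hs; apply: pfun_sum => j; apply: PMul.
  exact: (pfun_coef (c := fun b => coefF j b) Hs (coefFP j)).
apply: (@pfun_subst V W void W (fun v => match v with end) (fun w _ x => x w)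
  (fun _ x => monK j x)).
- by case.
- by move=> w; apply: PVar.
- exact: monKP.
Qed.

Section Types.
Variables (W : finType) (q : family W).
Implicit Types (x : W -> K) (b : par q -> F).

Definition row_of r (beta : 'I_r * par q -> F) (i : 'I_r) : par q -> F :=
  fun t => beta (i, t).

Definition cvec b : 'rV[K]_(len q) := \row_j coefF j b.
Definition cmx r (beta : 'I_r * par q -> F) : 'M[K]_(r, len q) :=
  \matrix_(i, j) coefF j (row_of beta i).

Definition vanishing r (beta : 'I_r * par q -> F) x :=
  forall i, value (row_of beta i) x = 0.
Definition spans r (beta : 'I_r * par q -> F) b := (cvec b <= cmx beta)%MS.
Definition free r (beta : 'I_r * par q -> F) := row_free (cmx beta).
(** Such a finite [beta] records the infinite set of all [b] with [value b x = 0], which is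
what a bounded predicate can know about [x]. *)
Definition type_basis r (beta : 'I_r * par q -> F) x :=
  vanishing beta x /\ forall b, value b x = 0 -> spans beta b.
Definition rank_ge r x := exists beta : 'I_r * par q -> F, free beta /\ vanishing beta x.

Lemma mul_cmx r (beta : 'I_r * par q -> F) (u : 'rV_r) j :
  (u *m cmx beta) 0 j = \sum_i u 0 i * coefF j (row_of beta i).
Proof. by rewrite mxE; apply: eq_bigr => i _; rewrite mxE. Qed.

Lemma spans_vanishing r (beta : 'I_r * par q -> F) b x :
  vanishing beta x -> spans beta b -> value b x = 0.
Proof.
move=> van /submxP[u bu].
have cE j : coefF j b = \sum_i u 0 i * coefF j (row_of beta i).
  by rewrite -mul_cmx -bu mxE.
rewrite /value (eq_bigr _ (fun j _ => congr1 (fun c => c * _) (cE j))).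
under eq_bigr => j _ do rewrite mulr_suml.
rewrite exchange_big big1 // => i _.
under eq_bigr => j _ do rewrite -mulrA.
by rewrite -mulr_sumr -/(value _ _) van mulr0.
Qed.

Lemma type_basis_value r (beta : 'I_r * par q -> F) b x :
  type_basis beta x -> value b x = 0 <-> spans beta b.
Proof. by case=> van spn; split=> [/spn|/(spans_vanishing van)]. Qed.

Lemma free_le r (beta : 'I_r * par q -> F) : free beta -> (r <= len q)%N.
Proof. by move=> /eqP <-; apply: rank_leq_col. Qed.

Lemma rank_ge0 x : rank_ge 0 x.
Proof.
exists (fun it : 'I_0 * par q =>
  match it.1 with Ordinal _ lti => False_rect F (notF lti) end).
split; last by case.
by rewrite /free /row_free -leqn0 rank_leq_row.
Qed.

(** A coefficient vector vanishing at [x] outside the span would enlarge [beta]. *)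
Lemma free_type_basis r (beta : 'I_r * par q -> F) x :
  free beta -> vanishing beta x -> ~ rank_ge r.+1 x -> type_basis beta x.
Proof.
move=> fb van nge; split=> // b bx; apply: contrapT => nspan; apply: nge.
pose beta' (it : 'I_r.+1 * par q) :=
  oapp (fun i => beta (i, it.2)) (b it.2) (unlift ord0 it.1).
have row0 : row_of beta' ord0 = b.
  by apply: funext => t; rewrite /row_of /beta' /= unlift_none.
have rowS i : row_of beta' (lift ord0 i) = row_of beta i.
  by apply: funext => t; rewrite /row_of /beta' /= liftK.
exists beta'; split; last first.
  by move=> i; case: (unliftP ord0 i) => [j ->|->]; rewrite ?row0 ?rowS.
apply: inj_row_free => u uc.
have u0 : u 0 ord0 = 0.
  apply/eqP; apply: contrapT => /negP u0; apply: nspan.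
  apply/submxP; exists (\row_i (- (u 0 ord0)^-1 * u 0 (lift ord0 i))).
  apply/rowP => j; have := congr1 (fun m : 'rV_(len q) => m 0 j) uc.
  rewrite !mul_cmx !mxE big_ord_recl row0 => /eqP; rewrite addr_eq0 => /eqP e.
  apply: (mulfI u0); rewrite e mulr_sumr -sumrN; apply: eq_bigr => i _.
  by rewrite mxE rowS mulrA mulrA mulrN divff // mulN1r mulNr.
have uS : \row_i u 0 (lift ord0 i) = 0.
  apply: (row_free_injr fb); rewrite /= mul0mx; apply/rowP => j.
  have := congr1 (fun m : 'rV_(len q) => m 0 j) uc.
  rewrite !mul_cmx !mxE big_ord_recl u0 mul0r add0r => e; rewrite -[RHS]e.
  by apply: eq_bigr => i _; rewrite mxE rowS.
apply/rowP => i; rewrite mxE; case: (unliftP ord0 i) => [j ->|->//].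
by have := congr1 (fun m : 'rV_r => m 0 j) uS; rewrite !mxE.
Qed.

Lemma exact_rank x : exists2 r, (r <= len q)%N & rank_ge r x /\ ~ rank_ge r.+1 x.
Proof.
pose P r := `[< rank_ge r x >].
have exP : exists r, P r by exists 0%N; apply/asboolP/rank_ge0.
have ubP r : P r -> (r <= len q)%N by move=> /asboolP[beta [/free_le]].
case: (ex_maxnP exP ubP) => r /asboolP Pr maxr.
exists r; first by apply: ubP; apply/asboolP.
by split=> // /asboolP/maxr; rewrite ltnn.
Qed.

(** Membership in a span is an existential statement over K about character values.  This
is harmless: conditions on F may be arbitrary formulas of the language. *)
Lemma dfnF_spans V r (bf : 'I_r * par q -> (V -> F) -> F) (cf : par q -> (V -> F) -> F) :
  (forall it, fterm (bf it)) -> (forall t, fterm (cf t)) ->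
  dfnF (fun a => spans (bf ^~ a) (cf ^~ a)).
Proof.
move=> Hb Hc.
have D : dfn chi (fun (a : V -> F) (l : void + 'I_r -> K) => forall j : 'I_(len q),
    coefF j (cf ^~ a) = \sum_i l (inr i) * coefF j (row_of (bf ^~ a) i)).
  apply: dfn_all => j; apply: dfn_pfun; first exact: pfun_coef (coefFP j).
  apply: pfun_sum => i; apply: PMul; first exact: PVar.
  by apply: (pfun_coef (s := fun t => bf (i, t)) _ (coefFP j)).
apply: dfn_ext (dfn_exKs D) => a x; split=> [[l Hl]|/submxP[u Hu]].
  apply/submxP; exists (\row_i l i); apply/rowP => j.
  by rewrite mul_cmx mxE Hl; apply: eq_bigr => i _; rewrite mxE.
by exists (u 0) => j; rewrite -mul_cmx -Hu mxE.
Qed.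

Lemma dfnF_free V r (bf : 'I_r * par q -> (V -> F) -> F) :
  (forall it, fterm (bf it)) -> dfnF (fun a => free (bf ^~ a)).
Proof.
move=> Hb.
have D : dfn chi (fun (a : V -> F) (l : void + 'I_r -> K) =>
    (forall j : 'I_(len q), \sum_i l (inr i) * coefF j (row_of (bf ^~ a) i) = 0) /\
    ~ (forall i : 'I_r, l (inr i) = 0)).
  apply: dfn_and.
    apply: dfn_all => j; apply: dfn_pfun; last exact: PZero.
    apply: pfun_sum => i; apply: PMul; first exact: PVar.
    by apply: (pfun_coef (s := fun t => bf (i, t)) _ (coefFP j)).
  apply: dfn_not; apply: dfn_all => i; apply: dfn_pfun; [exact: PVar|exact: PZero].
apply: dfn_ext (dfn_not (dfn_exKs D)) => a x; split=> [nex|fb [l [Hl nl]]].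
  apply: inj_row_free => u u0; apply/rowP => i; rewrite mxE.
  apply: contrapT => ui; apply: nex; exists (u 0); split=> [j|u00].
    by rewrite -mul_cmx u0 mxE.
  by apply: ui; apply: u00.
apply: nl => i.
have : \row_i l i = 0.
  apply: (row_free_injr fb); rewrite /= mul0mx; apply/rowP => j.
  by rewrite mul_cmx !mxE -[RHS](Hl j); apply: eq_bigr => k _; rewrite mxE.
by move=> /rowP/(_ i); rewrite !mxE.
Qed.

End Types.

(** * Bounded predicates *)

Section Bounded.
Variable W : finType.

(** Only the quantifiers that see [x] are restricted to F; in [BddF] the condition [D] may
use quantifiers over K. *)
Inductive bdd : forall V : finType, ((V -> F) -> (W -> K) -> Prop) -> Prop :=
| BddF V (D : (V -> F) -> Prop) of dfnF D : bdd (fun a _ => D a)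
| BddP V (p : (V -> F) -> (W -> K) -> K) of pfun p : bdd (fun a x => p a x = 0)
| BddN V (G : (V -> F) -> (W -> K) -> Prop) of bdd G : bdd (fun a x => ~ G a x)
| BddI V (G H : (V -> F) -> (W -> K) -> Prop) of bdd G & bdd H :
    bdd (fun a x => G a x /\ H a x)
| BddX V (G : (option V -> F) -> (W -> K) -> Prop) of bdd G :
    bdd (fun a x => exists b, G (oapp a b) x).

Lemma bdd_ext V (G H : (V -> F) -> (W -> K) -> Prop) :
  (forall a x, G a x <-> H a x) -> bdd G -> bdd H.
Proof.
move=> GH; suff -> : G = H by [].
by apply: funext => a; apply: funext => x; apply: propext.
Qed.

Lemma bdd_or V (G H : (V -> F) -> (W -> K) -> Prop) :
  bdd G -> bdd H -> bdd (fun a x => G a x \/ H a x).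
Proof.
move=> dG dH; apply: bdd_ext (BddN (BddI (BddN dG) (BddN dH))) => a x.
by rewrite not_andE !notK.
Qed.

Lemma bdd_imply V (G H : (V -> F) -> (W -> K) -> Prop) :
  bdd G -> bdd H -> bdd (fun a x => G a x -> H a x).
Proof.
by move=> dG dH; apply: bdd_ext (bdd_or (BddN dG) dH) => a x; rewrite implyE.
Qed.

Lemma bdd_true V : bdd (fun (_ : V -> F) _ => True).
Proof. exact: BddF (dfn_true _ _ _). Qed.

Lemma bdd_ren V V' (r : V -> V') (G : (V -> F) -> (W -> K) -> Prop) :
  bdd G -> bdd (fun a x => G (a \o r) x).
Proof.
move=> bG; elim: bG V' r => {V G}.
- by move=> V D dD V' r; apply: BddF; apply: dfnF_ren.
- by move=> V p Hp V' r; apply: BddP (pfun_ren r id Hp).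
- by move=> V G _ IH V' r; apply: BddN (IH _ _).
- by move=> V G H _ IHG _ IHH V' r; apply: BddI (IHG _ _) (IHH _ _).
- move=> V G _ IH V' r; apply: bdd_ext (BddX (IH _ (omap r))) => a x.
  by split=> -[b Hb]; exists b; move: Hb; rewrite oapp_omap.
Qed.

Lemma bdd_exFs V T (G : (V + T -> F) -> (W -> K) -> Prop) :
  bdd G -> bdd (fun a x => exists b, G (join a b) x).
Proof.
apply: (@ex_block F (W -> K) (fun U H => bdd H)) => [U U' r H|U H].
  exact: bdd_ren.
exact: BddX.
Qed.

Lemma bdd_allFs V T (G : (V + T -> F) -> (W -> K) -> Prop) :
  bdd G -> bdd (fun a x => forall b, G (join a b) x).
Proof.
move=> dG; apply: bdd_ext (BddN (bdd_exFs (BddN dG))) => a x.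
split=> [nG b|Gb [b]]; last exact.
by apply: contrapT => nGb; apply: nG; exists b.
Qed.

Lemma bdd_all V (I : finType) (G : I -> (V -> F) -> (W -> K) -> Prop) :
  (forall i, bdd (G i)) -> bdd (fun a x => forall i, G i a x).
Proof.
move=> dG.
suff: forall s : seq I, bdd (fun a x => forall i, i \in s -> G i a x).
  move=> /(_ (enum I)); apply: bdd_ext => a x.
  by split=> H i; [apply: H; rewrite mem_enum|move=> _].
elim=> [|i s IHs]; first by apply: bdd_ext (bdd_true _).
apply: bdd_ext (BddI (dG i) IHs) => a x; split=> [[Hi Hs] j|H].
  by rewrite inE => /predU1P[->|/Hs].
by split=> [|j js]; apply: H; rewrite inE ?eqxx // js orbT.
Qed.

Lemma bdd_ex V (I : finType) (G : I -> (V -> F) -> (W -> K) -> Prop) :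
  (forall i, bdd (G i)) -> bdd (fun a x => exists i, G i a x).
Proof.
move=> dG; apply: bdd_ext (BddN (bdd_all (fun i => BddN (dG i)))) => a x.
split=> [nG|[i Gi] nG]; last exact: nG Gi.
by apply: contrapT => nex; apply: nG => i Gi; apply: nex; exists i.
Qed.

Definition covers (q q0 : family W) := exists s : par q -> (par q0 -> F) -> F,
  (forall t, fterm (s t)) /\ forall b x, value (q := q0) b x = value (s ^~ b) x.

Lemma covers_refl q : covers q q.
Proof. by exists (fun t b => b t); split=> // t; apply: FVar. Qed.

Lemma covers_trans q2 q1 q0 : covers q2 q1 -> covers q1 q0 -> covers q2 q0.
Proof.
move=> [s [Hs sE]] [u [Hu uE]]; exists (fun t b => s t (u ^~ b)); split=> [t|b x].
  exact: fterm_subst.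
by rewrite uE sE.
Qed.

Hypothesis chi0 : chi 0 = 0.
Hypothesis chi1 : chi 1 = 1.

(** Two families are merged by a switch: since [chi 0 = 0] and [chi 1 = 1], two extra
parameters in {0, 1} turn either polynomial on or off. *)
Lemma common_cover q1 q2 : exists q, covers q q1 /\ covers q q2.
Proof.
pose T : finType := (par q1 + par q2 + bool)%type.
pose c (j : 'I_(len q1 + len q2)) (b : T -> F) : K :=
  match split j with
  | inl j => chi (b (inr true)) * coefF j (fun t => b (inl (inl t)))
  | inr j => chi (b (inr false)) * coefF j (fun t => b (inl (inr t)))
  end.
pose z (j : 'I_(len q1 + len q2)) (x : W -> K) : K :=
  match split j with inl j => monK j x | inr j => monK j x end.
have cP j : @pfun T void (fun b _ => c j b).
  rewrite /c; case: split => k.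
    apply: PMul; first by apply: PChi; apply: FVar.
    by apply: (pfun_coef (s := fun t b => b (inl (inl t))) _ (coefFP k)) => t; apply: FVar.
  apply: PMul; first by apply: PChi; apply: FVar.
  by apply: (pfun_coef (s := fun t b => b (inl (inr t))) _ (coefFP k)) => t; apply: FVar.
have zP j : @pfun void W (fun _ x => z j x).
  by rewrite /z; case: split => k; apply: monKP.
have vE (b : T -> F) x : value (q := Family cP zP) b x =
    chi (b (inr true)) * value (fun t => b (inl (inl t))) x +
    chi (b (inr false)) * value (fun t => b (inl (inr t))) x.
  rewrite /value /= big_split_ord /= !mulr_sumr; congr (_ + _);
    apply: eq_bigr => j _; rewrite /c /z.
    by rewrite (unsplitK (inl j)) mulrA.
  by rewrite (unsplitK (inr j)) mulrA.
exists (Family cP zP); split.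
  exists (fun (t : T) b => match t with
    | inl (inl t) => b t | inr true => 1 | _ => 0 end); split.
    by case=> [[t|t]|[]]; [apply: FVar|apply: FZero|apply: FOne|apply: FZero].
  by move=> b x; rewrite vE chi1 chi0 mul1r mul0r addr0.
exists (fun (t : T) b => match t with
  | inl (inr t) => b t | inr false => 1 | _ => 0 end); split.
  by case=> [[t|t]|[]]; [apply: FZero|apply: FVar|apply: FZero|apply: FOne].
by move=> b x; rewrite vE chi1 chi0 mul1r mul0r add0r.
Qed.

Definition determined V (G : (V -> F) -> (W -> K) -> Prop) (q : family W) :=
  forall r, exists D : (V -> F) -> ('I_r * par q -> F) -> Prop,
    @dfnF (V + 'I_r * par q)%type (fun e => D (e \o inl) (e \o inr)) /\
    forall a x beta, type_basis beta x -> (G a x <-> D a beta).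

(** The statement quantifies over all covers of [q0] so that the two sides of a conjunction
can be brought to the same family.  Quantifiers over F commute with the type basis,
which depends on [x] only. *)
Lemma bdd_determined V (G : (V -> F) -> (W -> K) -> Prop) : bdd G ->
  exists q0, forall q, covers q q0 -> determined G q.
Proof.
elim=> {V G}.
- move=> V D dD.
  have cP (j : 'I_0) : @pfun void void (fun b _ => 0 : K) by case: j.
  have zP (j : 'I_0) : @pfun void W (fun _ x => 0 : K) by case: j.
  exists (Family cP zP) => q _ r; exists (fun a _ => D a); split=> //.
  exact: (dfnF_ren inl dD).
- move=> V p Hp; have [n [c [z [cP zP pE]]]] := pfun_family Hp.
  exists (Family cP zP) => q [s [Hs sE]] r.
  exists (fun a beta => spans beta (s ^~ a)); split.
    apply: (dfnF_spans (bf := fun it e => e (inr it)) (cf := fun t e => s t (e \o inl))).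
      by move=> it; apply: FVar.
    move=> t; apply: (fterm_subst (s := fun v e => e (inl v))) => // v.
    exact: FVar.
  move=> a x beta tb; rewrite -(type_basis_value _ tb) -(sE a x) pE; exact: iff_refl.
- move=> V G _ [q0 IH]; exists q0 => q /IH dG r.
  have [D [dD DE]] := dG r; exists (fun a beta => ~ D a beta); split.
    exact: dfn_not.
  by move=> a x beta /DE ->.
- move=> V G H _ [q1 IHG] _ [q2 IHH].
  have [q0 [c1 c2]] := common_cover q1 q2.
  exists q0 => q cq r.
  have [D [dD DE]] := IHG q (covers_trans cq c1) r.
  have [E [dE EE]] := IHH q (covers_trans cq c2) r.
  exists (fun a beta => D a beta /\ E a beta); split; first exact: dfn_and.
  by move=> a x beta tb; rewrite (DE _ _ _ tb) (EE _ _ _ tb).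
- move=> V G _ [q0 IH]; exists q0 => q /IH dG r.
  have [D [dD DE]] := dG r.
  exists (fun a beta => exists b, D (oapp a b) beta); split.
    pose f (w : option V + 'I_r * par q) : option (V + 'I_r * par q) :=
      match w with inl v => omap inl v | inr it => Some (inr it) end.
    apply: dfn_ext (dfn_exF (dfnF_ren f dD)) => e _ /=.
    suff eE b : (oapp e b \o f) \o inl = oapp (e \o inl) b.
      by split=> -[b Db]; exists b; move: Db; rewrite eE.
    by apply: funext => -[].
  move=> a x beta tb; split=> -[b Hb]; exists b; exact/(DE _ _ _ tb).
Qed.

Lemma bdd_type V (G : (V -> F) -> (W -> K) -> Prop) : bdd G -> exists q, determined G q.
Proof. by move=> /bdd_determined[q /(_ q (covers_refl q))]; exists q. Qed.

End Bounded.

End PolynomialFunctions.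

(** * Eliminating one algebraic variable *)

Section CommonRoots.
Local Open Scope ring_scope.
Variable K : closedFieldType.

Lemma closed_dvdp_exp (g h : {poly K}) d : g != 0 -> (size g <= d.+1)%N ->
  (forall y, root g y -> root h y) -> g %| h ^+ d.
Proof.
move=> g0 szg gh.
have [s gE] := closed_field_poly_normal g.
have lg0 : lead_coef g != 0 by rewrite lead_coef_eq0.
have szs : (size s <= d)%N.
  by move: szg; rewrite gE size_scale // size_prod_XsubC.
have sh y : y \in s -> 'X - y%:P %| h.
  by move=> ys; rewrite dvdp_XsubCl gh // gE rootZ // root_prod_XsubC.
rewrite gE dvdpZl // (dvdp_trans _ (dvdp_exp2l h szs)) //.
elim: s sh {gE szs} => [|y s IHs] sh; first by rewrite big_nil dvd1p.
rewrite big_cons exprS dvdp_mul ?sh ?mem_head ?IHs // => z zs.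
by apply: sh; rewrite inE zs orbT.
Qed.

(** An effective Nullstellensatz in one variable.  If every common root of the [P i] is a
root of [h], then the gcd of the [P i], having degree at most [d], divides [h^d]; and
in a combination equal to [h^d] the multipliers can be reduced modulo [P i0], which
bounds their degrees. *)
Lemma common_root_combination (I : finType) (P : I -> {poly K}) (i0 : I)
    (h : {poly K}) d D : P i0 != 0 -> (size (P i0) <= d.+1)%N ->
  (d + (size h * d + \max_i size (P i)) < D)%N ->
  (exists y, (forall i, root (P i) y) /\ ~~ root h y) <->
  ~ exists u : I -> {poly K}, (forall i, (size (u i) <= D)%N) /\
     h ^+ d = \sum_i u i * P i.
Proof.
set p := P i0 => p0 szp ltD; split=> [[y [Py hy]] [u [_ e]]|nu].
  move/eqP: (congr1 (fun f => f.[y]) e); rewrite horner_exp horner_sum big1.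
    by rewrite expf_eq0; move: hy; rewrite rootE => /negPf ->; rewrite andbF.
  by move=> i _; rewrite hornerM (rootP (Py i)) mulr0.
apply: contrapT => nroot; apply: nu.
pose J (f : {poly K}) := exists u : I -> {poly K}, f = \sum_i u i * P i.
have JD f g : J f -> J g -> J (f + g).
  move=> [u ->] [v ->]; exists (fun k => u k + v k).
  by rewrite -big_split; apply: eq_bigr => k _; rewrite mulrDl.
have JM f g : J f -> J (g * f).
  move=> [u ->]; exists (fun k => g * u k).
  by rewrite mulr_sumr; apply: eq_bigr => k _; rewrite mulrA.
have JP i : J (P i).
  exists (fun k => (k == i)%:R); rewrite (bigD1 i) //= eqxx mul1r big1 ?addr0 //.
  by move=> k /negPf ->; rewrite mul0r.
pose small n := `[< exists g : {poly K}, [/\ J g, g != 0 & size g = n] >].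
have exs : exists n, small n.
  by exists (size p); apply/asboolP; exists p; split=> //; apply: JP.
case: (ex_minnP exs) => n /asboolP[g [Jg g0 szg]] ming.
have gJ f : J f -> g %| f.
  move=> Jf; apply: contrapT => /negP; rewrite /dvdp => fg0.
  have Jr : J (f %% g).
    rewrite (_ : f %% g = f + (- (f %/ g)) * g); first exact: JD (JM _ _ Jg).
    by rewrite {2}(divp_eq f g) mulNr addrAC subrr add0r.
  have : (n <= size (f %% g)%R)%N by apply: ming; apply/asboolP; exists (f %% g).
  by rewrite -szg leqNgt ltn_modp g0.
have [u hE] : J (h ^+ d).
  have /dvdpP[c ->] : g %| h ^+ d; last exact: JM.
  apply: closed_dvdp_exp => // [|y gy].
    apply: leq_trans szp; rewrite szg; apply: ming; apply/asboolP.
    by exists p; split=> //; apply: JP.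
  apply: contrapT => /negP hy; apply: nroot; exists y; split=> // i.
  rewrite -dvdp_XsubCl (dvdp_trans _ (gJ _ (JP i))) //.
  by rewrite dvdp_XsubCl.
pose w i := if i == i0 then u i0 + \sum_(k | k != i0) (u k %/ p) * P k else u i %% p.
have wE i : i != i0 -> w i = u i %% p by move=> /negPf ni; rewrite /w ni.
have hw : h ^+ d = \sum_i w i * P i.
  rewrite hE (bigD1 i0) //= [RHS](bigD1 i0) //= /w eqxx mulrDl -addrA; congr (_ + _).
  rewrite mulr_suml -big_split; apply: eq_bigr => i /negPf ->.
  by rewrite {1}(divp_eq (u i) p) -/p /=; ring.
have szw i : i != i0 -> (size (w i) <= d)%N.
  move=> ni; rewrite wE // -ltnS; apply: leq_trans szp.
  by rewrite ltn_modp.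
exists w; split=> // i; have [->|ni] := eqVneq i i0; last first.
  by have := szw i ni; lia.
have wpE : w i0 * p = h ^+ d - \sum_(i | i != i0) w i * P i.
  by rewrite hw (bigD1 i0) //= addrK.
have szwp : (size (w i0 * p)%R <= D)%N.
  rewrite wpE; apply: leq_trans (size_polyD _ _) _; rewrite size_polyN geq_max.
  apply/andP; split; first by have := size_poly_exp_leq h d; nia.
  apply: leq_trans (size_sum _ _ _) _; apply/bigmax_leqP => k nk.
  apply: leq_trans (size_polyMleq _ _) _.
  have := leq_bigmax (F := fun i => size (P i)) k; have := szw k nk.
  move: ltD; move: (size (w k)) (size (P k)) (\max_i _)%N (size h * d)%N.
  by move=> a b c e; lia.
have [->|w0] := eqVneq (w i0) 0; first by rewrite size_poly0.
move: szwp; rewrite size_mul //; move: p0; rewrite -size_poly_gt0.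
by case: (size p) => // k _; rewrite addnS; apply: leq_trans; apply: leq_addr.
Qed.

End CommonRoots.

Section Elimination.
Local Open Scope ring_scope.
Variables (F : fieldType) (K : closedFieldType) (chi : F -> K).
Variable W : finType.

(** Gaussian elimination: either the first column vanishes, or one of its entries serves
as a pivot.  Cross-multiplication replaces division by the pivot. *)
Lemma bdd_linear (V E : finType) n (A : E -> 'I_n -> (V -> F) -> (W -> K) -> K)
    (b : E -> (V -> F) -> (W -> K) -> K) :
  (forall k i, pfun chi (A k i)) -> (forall k, pfun chi (b k)) ->
  bdd chi (fun a x => exists l : 'I_n -> K, forall k, b k a x = \sum_i A k i a x * l i).
Proof.
elim: n A b => [|n IHn] A b HA Hb.
  apply: bdd_ext (bdd_all (fun k => BddP (Hb k))) => a x.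
  split=> [b0|[l bl] k]; last by rewrite bl big_ord0.
  by exists (fun=> 0) => k; rewrite big_ord0.
pose A0 k := A k ord0; pose A' k i := A k (lift ord0 i).
have B1 := BddI (bdd_all (fun k => BddP (HA k ord0)))
   (IHn A' b (fun k i => HA k _) Hb).
have B2 := bdd_ex (fun k0 => BddI (BddN (BddP (HA k0 ord0)))
   (IHn (fun k i a x => A k0 ord0 a x * A' k i a x + - (A k ord0 a x * A' k0 i a x))
        (fun k a x => A k0 ord0 a x * b k a x + - (A k ord0 a x * b k0 a x))
     (fun k i => PAdd (PMul (HA k0 _) (HA k _)) (POpp (PMul (HA k _) (HA k0 _))))
     (fun k => PAdd (PMul (HA k0 _) (Hb k)) (POpp (PMul (HA k _) (Hb k0)))))).
apply: bdd_ext (bdd_or B1 B2) => a x; split.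
  case=> [[a0 [l bl]]|[k0 [/eqP a0 [l bl]]]].
    exists (fun i => oapp l 0 (unlift ord0 i)) => k.
    rewrite big_ord_recl a0 mul0r add0r bl; apply: eq_bigr => i _.
    by rewrite liftK.
  pose l0 := (A k0 ord0 a x)^-1 * (b k0 a x - \sum_i A' k0 i a x * l i).
  exists (fun i => oapp l l0 (unlift ord0 i)) => k.
  rewrite big_ord_recl unlift_none /=; under eq_bigr => i _ do rewrite liftK /=.
  apply: (mulfI a0); rewrite mulrDr.
  have -> : A k0 ord0 a x * (A k ord0 a x * l0) =
      A k ord0 a x * (b k0 a x - \sum_i A' k0 i a x * l i).
    by rewrite mulrCA /l0 mulVKf.
  have /= := bl k; under eq_bigr => i _ do rewrite mulrDl mulNr -!mulrA.
  rewrite big_split /= sumrN -!mulr_sumr /A'.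
  by move=> /eqP; rewrite subr_eq => /eqP ->; ring.
case=> l bl; have [a0|] := EM (forall k, A k ord0 a x = 0).
  left; split=> //; exists (l \o lift ord0) => k.
  by rewrite bl big_ord_recl a0 mul0r add0r.
move=> na0; have [k0 a0] : exists k0, A k0 ord0 a x <> 0.
  by apply: contrapT => nk; apply: na0 => k; apply: contrapT => ak; apply: nk; exists k.
right; exists k0; split=> //; exists (l \o lift ord0) => k.
under eq_bigr => i _ do rewrite mulrDl mulNr -!mulrA.
rewrite big_split /= sumrN -!mulr_sumr !bl !big_ord_recl /A' /=.
by ring.
Qed.

Section PolynomialFamilies.
Variable V : finType.

Definition polyfam d (P : (V -> F) -> (W -> K) -> {poly K}) :=
  (forall j, pfun chi (fun a x => (P a x)`_j)) /\ forall a x, (size (P a x) <= d)%N.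

Lemma polyfamC p : pfun chi p -> polyfam 1 (fun a x => (p a x)%:P).
Proof.
move=> Hp; split=> [j|a x]; last exact: size_polyC_leq1.
rewrite (_ : (fun a x => _) = if j == 0%N then p else fun _ _ => 0).
  by case: ifP => // _; apply: PZero.
by apply: funext => a; apply: funext => x; rewrite coefC; case: ifP.
Qed.

Lemma polyfamD d e P Q : polyfam d P -> polyfam e Q ->
  polyfam (maxn d e) (fun a x => P a x + Q a x).
Proof.
move=> [HP szP] [HQ szQ]; split=> [j|a x].
  rewrite (_ : (fun a x => _) = fun a x => (P a x)`_j + (Q a x)`_j).
    exact: PAdd.
  by apply: funext => a; apply: funext => x; rewrite coefD.
apply: leq_trans (size_polyD _ _) _; rewrite geq_max !leq_max szP szQ orbT.
by [].
Qed.

Lemma polyfamN d P : polyfam d P -> polyfam d (fun a x => - P a x).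
Proof.
move=> [HP szP]; split=> [j|a x]; last by rewrite size_polyN.
rewrite (_ : (fun a x => _) = fun a x => - (P a x)`_j); first exact: POpp.
by apply: funext => a; apply: funext => x; rewrite coefN.
Qed.

Lemma polyfamM d e P Q : polyfam d P -> polyfam e Q ->
  polyfam (d + e) (fun a x => P a x * Q a x).
Proof.
move=> [HP szP] [HQ szQ]; split=> [j|a x].
  rewrite (_ : (fun a x => _) = fun a x => \sum_(i < j.+1) (P a x)`_i * (Q a x)`_(j - i)).
    by apply: pfun_sum => i; apply: PMul.
  by apply: funext => a; apply: funext => x; rewrite coefM.
apply: leq_trans (size_polyMleq _ _) _.
by have := szP a x; have := szQ a x; lia.
Qed.

Lemma polyfamX d n P : polyfam d P -> exists e, polyfam e (fun a x => P a x ^+ n).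
Proof.
move=> HP; elim: n => [|n [e HPn]].
  by exists 1%N; apply: (polyfamC (p := fun _ _ => 1) (POne _ _ _)).
exists (d + e)%N; have := polyfamM HP HPn.
by congr polyfam; apply: funext => a; apply: funext => x; rewrite exprS.
Qed.

Lemma polyfam_prod (I : finType) (P : I -> (V -> F) -> (W -> K) -> {poly K}) :
  (forall i, exists d, polyfam d (P i)) ->
  exists d, polyfam d (fun a x => \prod_i P i a x).
Proof.
move=> HP; rewrite (_ : (fun a x => _) = \big[(fun p q a x => p a x * q a x)/
    (fun _ _ => 1)]_i P i).
  apply: (big_ind (fun f => exists d, polyfam d f)) => [|g h [d Hg] [e Hh]|i _].
  - by exists 1%N; apply: (polyfamC (p := fun _ _ => 1) (POne _ _ _)).
  - by exists (d + e)%N; apply: polyfamM.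
  - exact: HP.
apply: funext => a; apply: funext => x.
by elim/big_rec2: _ => // i y g _ ->.
Qed.

Lemma pfun_polyfam (p : (V -> F) -> (option W -> K) -> K) : pfun chi p ->
  exists d P, polyfam d P /\ forall a x y, p a (oapp x y) = (P a x).[y].
Proof.
elim=> [f Hf|w|||g h _ [d [P [HP Pg]]] _ [e [Q [HQ Qh]]]|g _ [d [P [HP Pg]]]
  |g h _ [d [P [HP Pg]]] _ [e [Q [HQ Qh]]]].
- exists 1%N, (fun a _ => (chi (f a))%:P); split=> [|a x y]; last by rewrite hornerC.
  exact: (polyfamC (PChi _ _ Hf)).
- case: w => [w|].
    exists 1%N, (fun _ x => (x w)%:P); split=> [|a x y]; last by rewrite hornerC.
    exact: (polyfamC (p := fun _ x => x w) (PVar _ _ w)).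
  exists 2%N, (fun _ _ => 'X); split=> [|a x y]; last by rewrite hornerX.
  split=> [j|a x]; last by rewrite size_polyX.
  by rewrite coefX; case: (j == 1%N); [apply: POne|apply: PZero].
- exists 1%N, (fun _ _ => 0%:P); split=> [|a x y]; last by rewrite hornerC.
  exact: (polyfamC (p := fun _ _ => 0) (PZero _ _ _)).
- exists 1%N, (fun _ _ => 1%:P); split=> [|a x y]; last by rewrite hornerC.
  exact: (polyfamC (p := fun _ _ => 1) (POne _ _ _)).
- exists (maxn d e), (fun a x => P a x + Q a x); split; first exact: polyfamD.
  by move=> a x y; rewrite hornerD Pg Qh.
- exists d, (fun a x => - P a x); split; first exact: polyfamN.
  by move=> a x y; rewrite hornerN Pg.
- exists (d + e)%N, (fun a x => P a x * Q a x); split; first exact: polyfamM.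
  by move=> a x y; rewrite hornerM Pg Qh.
Qed.

Lemma bdd_polyfam_eq0 d P : polyfam d P -> bdd chi (fun a x => P a x = 0).
Proof.
move=> [HP szP]; apply: bdd_ext (bdd_all (fun j : 'I_d => BddP (HP j))) => a x.
split=> [P0|-> j]; last by rewrite coef0.
apply/polyP => j; rewrite coef0; have [ltj|lej] := ltnP j d; first exact: P0 (Ordinal ltj).
by rewrite nth_default // (leq_trans (szP a x)).
Qed.

(** The existence of a common root amounts to the insolubility of a linear system, by
[common_root_combination]. *)
Lemma bdd_common_root (I : finType) (i0 : I) d m
    (P : I -> (V -> F) -> (W -> K) -> {poly K}) h :
  (forall i, polyfam d (P i)) -> polyfam m h ->
  bdd chi (fun a x => P i0 a x <> 0 /\
     exists y, (forall i, root (P i a x) y) /\ ~~ root (h a x) y).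
Proof.
move=> HP Hh; pose D := (d + (m * d + d)).+1.
have [m' Hhd] := polyfamX d Hh; pose E := (m' + (D + d))%N.
pose row (t : 'I_#|{: I * 'I_D}|) a x : {poly K} :=
  'X^((enum_val t).2) * P (enum_val t).1 a x.
pose eqn a x := exists l : 'I_#|{: I * 'I_D}| -> K, forall k : 'I_E,
  (h a x ^+ d)`_k = \sum_t (row t a x)`_k * l t.
have Beqn : bdd chi eqn.
  apply: bdd_linear => [k t|k]; last exact: Hhd.1.
  rewrite (_ : (fun a x => _) = if (k < (enum_val t).2)%N then fun _ _ => 0 else
      fun a x => (P (enum_val t).1 a x)`_(k - (enum_val t).2)).
    by case: ifP => _; [apply: PZero|apply: (HP _).1].
  by apply: funext => b; apply: funext => y; rewrite /row coefXnM; case: ifP.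
apply: bdd_ext (BddI (BddN (bdd_polyfam_eq0 (HP i0))) (BddN Beqn)) => a x.
suff comb : P i0 a x <> 0 -> (exists y, (forall i, root (P i a x) y) /\
    ~~ root (h a x) y) <-> ~ eqn a x.
  by split=> -[P0 /(comb P0)].
move=> /eqP P0.
rewrite (@common_root_combination K I (fun i => P i a x) i0 (h a x) d D) //; last first.
- rewrite /D ltnS leq_add2l leq_add //; first by rewrite leq_mul2r (Hh.2) orbT.
  by apply/bigmax_leqP => i _; apply: (HP i).2.
- by apply: leqW; apply: (HP i0).2.
split=> ne [l e]; apply: ne.
  pose c i (j : nat) : K := if insub j is Some j' then l (enum_rank (i, j' : 'I_D)) else 0.
  exists (fun i => \poly_(j < D) c i j); split=> [i|]; first exact: size_poly.
  have sumE : \sum_i (\poly_(j < D) c i j) * P i a x =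
      \sum_(t < #|{: I * 'I_D}|) l t *: row t a x.
    transitivity (\sum_i \sum_(j < D) l (enum_rank (i, j)) *: ('X^j * P i a x)).
      apply: eq_bigr => i _; rewrite poly_def mulr_suml; apply: eq_bigr => j _.
      by rewrite /c valK scalerAl.
    rewrite pair_bigA [RHS](reindex enum_rank) /=; last exact/onW_bij/enum_rank_bij.
    by apply: eq_bigr => -[i j] _; rewrite /row enum_rankK.
  rewrite sumE; apply/polyP => k; rewrite coef_sum.
  have [ltk|lek] := ltnP k E.
    rewrite (e (Ordinal ltk)); apply: eq_bigr => t _.
    by rewrite coefZ mulrC.
  rewrite nth_default ?(leq_trans (Hhd.2 a x)) ?(leq_trans _ lek) ?leq_addr //.
  rewrite big1 // => t _; rewrite coefZ /row coefXnM nth_default ?if_same ?mulr0 //.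
  have ltj : ((enum_val t).2 + d <= k)%N.
    apply: leq_trans lek; apply: leq_trans (leq_addl _ _).
    by rewrite leq_add2r ltnW.
  apply: leq_trans ((HP _).2 a x) _.
  by rewrite leq_subRL // (leq_trans (leq_addr _ _) ltj).
case: e => szl e.
exists (fun t : 'I_#|{: I * 'I_D}| => (l (enum_val t).1)`_((enum_val t).2)) => k.
rewrite e coef_sum.
transitivity (\sum_i \sum_(j < D) ('X^j * P i a x)`_k * (l i)`_j); last first.
  rewrite pair_bigA [RHS](reindex enum_rank) /=; last exact/onW_bij/enum_rank_bij.
  by apply: eq_bigr => -[i j] _; rewrite /row enum_rankK.
apply: eq_bigr => i _; rewrite -{1}(coefK (l i)).
have -> : \poly_(j < size (l i)) (l i)`_j = \poly_(j < D) (l i)`_j.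
  apply/polyP => j; rewrite !coef_poly; case: (ltnP j D) => ltj.
    by case: ltnP => // lej; rewrite nth_default.
  by rewrite ltnNge (leq_trans (szl i) ltj).
rewrite poly_def mulr_suml coef_sum; apply: eq_bigr => j _.
by rewrite -scalerAl coefZ mulrC.
Qed.

End PolynomialFamilies.

End Elimination.

(** * Eliminating quantifiers over the second sort *)

Section EliminationK.
Local Open Scope ring_scope.
Variables (F : fieldType) (K : closedFieldType) (chi : F -> K).
Hypothesis chi_gen : generic_character chi.
Hypothesis K_char0 : has_char 0 K.

Let chi_char : character chi. Proof. by case: chi_gen. Qed.

(** The length bound depends on the polynomial expression and not on the values of its
variables. *)
Lemma pfun_ssum (V : finType) (p : (V -> F) -> (void -> K) -> K) : pfun chi p ->
  exists T, forall a x, ssum chi (@mul_nonzero F) T (p a x).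
Proof.
have grp := mgroup_nonzero F.
elim=> [f _|[]|||g h _ [T HT] _ [U HU]|g _ [T HT]|g h _ [T HT] _ [U HU]].
- exists 1%N => a x; have [->|fa] := eqVneq (f a) 0; last exact: ssum_chi.
  by case: chi_char => _ -> _; apply: ssum_zero.
- by exists 0%N => a x; apply: ssum_zero.
- by exists 1%N => a x; case: chi_char => _ _ <-; apply: ssum_chi; case: grp.
- by exists (T + U)%N => a x; apply: ssum_add.
- by exists T => a x; apply: ssum_opp.
- by exists (T * U)%N => a x; apply: ssum_mul.
Qed.

Lemma polyfam_ren (W V V' : finType) (r : V -> V') d P :
  @polyfam F K chi W V d P -> polyfam chi d (fun a x => P (a \o r) x).
Proof. by move=> [HP szP]; split=> [j|a x //]; apply: (pfun_ren r id (HP j)). Qed.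

(** View the last variable [y] as the variable of a polynomial.  The third clause says that
for every [x] some integer is generic over [x] with respect to the family. *)
Lemma family_poly (W : finType) (q : family chi (option W)) :
  exists d (Q : (par q -> F) -> (W -> K) -> {poly K}),
    [/\ polyfam chi d Q, forall b x y, value b (oapp x y) = (Q b x).[y]
      & forall x, exists n : nat, forall b, (Q b x).[n%:R] = 0 -> Q b x = 0].
Proof.
have /choice[dP HdP] (j : 'I_(len q)) := pfun_polyfam (monKP j).
have /choice[P HP] (j : 'I_(len q)) := HdP j.
pose a0 : void -> F := fun v => match v with end.
pose Q (b : par q -> F) x := \sum_j coefF j b *: P j a0 x.
exists (\max_j dP j), Q; split.
- split=> [k|b x].
    rewrite (_ : (fun a x => _) = fun b x => \sum_j coefF j b * (P j a0 x)`_k).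
      apply: pfun_sum => j; apply: PMul.
        have H := @pfun_coef F K chi _ W _ (fun t b => b t) (coefF j)
          (fun t => FVar _ t) (coefFP j).
        by refine H.
      have := pfun_ren (fun v : void => match v return par q with end) id ((HP j).1.1 k).
      congr pfun; apply: funext => b; apply: funext => x.
      by congr (_`_k); congr (P j _ _); apply: funext => -[].
    apply: funext => b; apply: funext => x; rewrite coef_sum.
    by apply: eq_bigr => j _; rewrite coefZ.
  apply: leq_trans (size_sum _ _ _) _; apply/bigmax_leqP => j _.
  apply: leq_trans (size_scale_leq _ _) _; apply: leq_trans ((HP j).1.2 a0 x) _.
  exact: leq_bigmax.
- move=> b x y; rewrite /value horner_sum; apply: eq_bigr => j _.
  by rewrite hornerZ ((HP j).2 a0).
move=> x.
have /choice[T HT] (j : 'I_(len q)) := pfun_ssum (coefFP j).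
have [n Hn] := small_integer chi_gen K_char0 (\max_j T j) (fun j => P j a0 x).
exists n => b; apply: Hn => j.
exact: ssum_le (leq_bigmax _) (HT j b (fun v => match v with end)).
Qed.

(** Split according to whether [y] is generic over [x] ([G1]) or not ([G2]), and according
to the size [r] of a type basis. *)
Lemma bdd_exK (V W : finType) (G : (V -> F) -> (option W -> K) -> Prop) :
  bdd chi G -> bdd chi (fun a x => exists y, G a (oapp x y)).
Proof.
case: chi_char => _ chi0 chi1.
move=> /(bdd_type chi0 chi1)[q detG].
have [d [Q [HQ vQ smallQ]]] := family_poly q.
pose gen x y := forall b, (Q b x).[y] = 0 -> Q b x = 0.
pose G1 r a x := exists y, [/\ gen x y,
  exists beta : 'I_r * par q -> F, type_basis beta (oapp x y) & G a (oapp x y)].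
pose G2 r a x := exists y, [/\ ~ gen x y, rank_ge q r (oapp x y),
  ~ rank_ge q r.+1 (oapp x y) & G a (oapp x y)].
(* For generic y, a type basis of (x, y) is found among the b for which Q b x = 0,
   a condition that does not mention y. *)
have B1 r : bdd chi (G1 r).
  have [D [dD DE]] := detG r.
  pose H (e : V + 'I_r * par q -> F) (x : W -> K) :=
    [/\ forall i, Q (row_of (e \o inr) i) x = 0,
       forall b, Q b x = 0 -> spans (e \o inr) b & D (e \o inl) (e \o inr)].
  have BH : bdd chi H.
    have B2 : bdd chi (fun (e : (V + 'I_r * par q) + par q -> F) (x : W -> K) =>
        Q (e \o inr) x = 0 -> spans ((e \o inl) \o inr) (e \o inr)).
      apply: bdd_imply; first exact: (bdd_polyfam_eq0 (polyfam_ren inr HQ)).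
      apply: BddF.
      apply: (dfnF_spans (bf := fun it e => e (inl (inr it))) (cf := fun t e => e (inr t))).
        by move=> it; apply: FVar.
      by move=> t; apply: FVar.
    apply: bdd_ext (BddI (bdd_all (fun i : 'I_r => bdd_polyfam_eq0
      (polyfam_ren (fun t => inr (i, t)) HQ))) (BddI (bdd_allFs B2) (BddF _ dD))) => e x.
    by split=> [[h1 [h2 h3]]|[h1 h2 h3]]; split.
  apply: bdd_ext (bdd_exFs BH) => a x; split.
    case=> beta [Q0 spn Da]; have [n Hn] := smallQ x.
    have tb : type_basis beta (oapp x n%:R).
      split=> [i|b]; first by rewrite vQ Q0 horner0.
      by rewrite vQ => /Hn/spn.
    by exists n%:R; split=> //; [exists beta|apply/(DE _ _ _ tb)].
  case=> y [gy [beta tb] Gy]; exists beta; split.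
  - by move=> i; apply: gy; rewrite -vQ; apply: tb.1.
  - by move=> b b0; apply: tb.2; rewrite vQ b0 horner0.
  - exact/(DE _ _ _ tb).
(* For nongeneric y, b0 is a witness and bet a free family of size r vanishing at
   (x, y).  Y is then a set of fewer than d candidates for y, and some candidate has
   no free vanishing family of size r+1 unless d such families f, one for each root of
   Q b0 x, jointly exclude all of them. *)
have B2 r : bdd chi (G2 r).
  have [D [dD DE]] := detG r.
  pose T1 : finType := (par q + 'I_r * par q)%type.
  pose T2 : finType := ('I_d * ('I_r.+1 * par q))%type.
  pose b0 (e : V + T1 -> F) : par q -> F := fun t => e (inr (inl t)).
  pose bet (e : V + T1 -> F) : 'I_r * par q -> F := fun it => e (inr (inr it)).
  pose P (i : option 'I_r) (e : V + T1 -> F) x :=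
    Q (oapp (row_of (bet e)) (b0 e) i) x.
  have HP i : polyfam chi d (P i).
    case: i => [i|]; first exact: (polyfam_ren (fun t => inr (inr (i, t))) HQ).
    exact: (polyfam_ren (fun t => inr (inl t)) HQ).
  pose Y e x y := forall i, root (P i e x) y.
  pose row2 (l : 'I_d) (f : T2 -> F) : 'I_r.+1 * par q -> F := fun it => f (l, it).
  pose h (phi : {ffun 'I_d -> 'I_r.+1}) (e : (V + T1) + T2 -> F) (x : W -> K) : {poly K} :=
    \prod_l Q (row_of (row2 l (e \o inr)) (phi l)) x.
  have Hh phi : exists m, polyfam chi m (h phi).
    apply: polyfam_prod => l; exists d.
    exact: (polyfam_ren (fun t => inr (l, (phi l, t))) HQ).
  pose H e x := [/\ free (bet e), D (e \o inl) (bet e),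
    P None e x <> 0 /\ exists y, Y e x y /\ ~~ root 1 y
    & forall f : T2 -> F, (forall l, free (row2 l f)) -> exists phi,
       P None e x <> 0 /\ exists y, Y e x y /\ ~~ root (h phi (join e f) x) y].
  have BH : bdd chi H.
    have H1 : bdd chi (fun (e : V + T1 -> F) (_ : W -> K) => free (bet e)).
      apply: BddF; apply: (dfnF_free (bf := fun it e => e (inr (inr it)))) => it.
      exact: FVar.
    have H2 : bdd chi (fun (e : V + T1 -> F) (_ : W -> K) => D (e \o inl) (bet e)).
      apply: BddF; have := dfnF_ren (fun w : V + 'I_r * par q => match w return V + T1 with
        inl v => inl v | inr it => inr (inr it) end) dD.
      by [].
    have H3 : bdd chi (fun (e : V + T1 -> F) (x : W -> K) =>
        P None e x <> 0 /\ exists y, Y e x y /\ ~~ root 1 y).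
      exact: (bdd_common_root None HP (polyfamC (p := fun _ _ => 1) (POne _ _ _))).
    have H4 : bdd chi (fun (e : (V + T1) + T2 -> F) (x : W -> K) =>
       (forall l, free (row2 l (e \o inr))) -> exists phi,
       P None (e \o inl) x <> 0 /\ exists y, Y (e \o inl) x y /\ ~~ root (h phi e x) y).
      apply: bdd_imply.
        apply: bdd_all => l; apply: BddF.
        apply: (dfnF_free (bf := fun it e => e (inr (l, it)))) => it.
        exact: FVar.
      apply: bdd_ex => phi; have [m Hm] := Hh phi.
      exact: (bdd_common_root None (fun i => polyfam_ren inl (HP i)) Hm).
    apply: bdd_ext (BddI (BddI H1 H2) (BddI H3 (bdd_allFs H4))) => e x.
    by split=> [[[h1 h2] [h3 h4]]|[h1 h2 h3 h4]]; split.
  apply: bdd_ext (bdd_exFs BH) => a x; split.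
    case=> t; set e := join a t; case=> fb Da [P0 [y0 [Yy0 _]]] avoid.
    have van y : Y e x y -> vanishing (bet e) (oapp x y).
      by move=> Yy i; rewrite vQ; apply/rootP; apply: (Yy (Some i)).
    suff [y [Yy nge]] : exists y, Y e x y /\ ~ rank_ge q r.+1 (oapp x y).
      have tb := free_type_basis fb (van y Yy) nge.
      exists y; split=> //; last exact/(DE _ _ _ tb).
        by move=> /(_ _ (rootP (Yy None))).
      by exists (bet e); split=> //; apply: van.
    apply: contrapT => allge.
    have ge y : Y e x y -> rank_ge q r.+1 (oapp x y).
      by move=> Yy; apply: contrapT => nge; apply: allge; exists y.
    have [f0 [ff0 _]] := ge y0 Yy0.
    have [s sE] := closed_field_poly_normal (P None e x).
    have /choice[f Hf] (y : K) : exists f : 'I_r.+1 * par q -> F,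
        free f /\ (Y e x y -> vanishing f (oapp x y)).
      have [/ge[f [ff vf]]|nY] := EM (Y e x y); first by exists f.
      by exists f0; split=> // /nY.
    have [l|phi [_ [y [Yy]]]] := avoid (fun lt => f s`_lt.1 lt.2).
      by rewrite (_ : row2 l _ = f s`_l); [exact: (Hf _).1|apply: funext => -[]].
    have lP0 : lead_coef (P None e x) != 0 by rewrite lead_coef_eq0; apply/eqP.
    have ys : y \in s.
      by have := Yy None; rewrite sE rootZ // root_prod_XsubC.
    have szs : (size s < d)%N.
      by have := (HP None).2 e x; rewrite sE size_scale // size_prod_XsubC.
    have ltd : (index y s < d)%N by apply: ltn_trans szs; rewrite index_mem.
    pose l := Ordinal ltd.
    rewrite rootE /h horner_prod (bigD1 l) //=.
    suff -> : (Q (row_of (row2 l (fun lt => f s`_lt.1 lt.2)) (phi l)) x).[y] = 0.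
      by rewrite mul0r eqxx.
    rewrite -vQ.
    have := (Hf y).2 Yy (phi l); rewrite /row_of /row2 /=.
    by rewrite nth_index.
  case=> y [ngen [bt [fb van]] nge Gy].
  have [c [cy c0]] : exists c, (Q c x).[y] = 0 /\ Q c x <> 0.
    apply: contrapT => nc; apply: ngen => c cy; apply: contrapT => c0; apply: nc.
    by exists c.
  exists (join c bt).
  have Yy : Y (join a (join c bt)) x y.
    by case=> [i|]; apply/rootP => //; rewrite -vQ; apply: van.
  split=> //.
  - by apply/(DE _ _ _ (free_type_basis fb van nge)).
  - by split=> //; exists y; rewrite root1.
  move=> f ff.
  have /choice[phi Hphi] (l : 'I_d) : exists i, (Q (row_of (row2 l f) i) x).[y] <> 0.
    apply: contrapT => ni; apply: nge; exists (row2 l f); split=> // i.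
    by rewrite vQ; apply: contrapT => nv; apply: ni; exists i.
  exists (finfun phi); split=> //; exists y; split=> //.
  rewrite rootE /h horner_prod; apply/prodf_neq0 => l _; rewrite ffunE.
  exact/eqP/Hphi.
apply: bdd_ext (bdd_ex (fun r : 'I_(len q).+1 => bdd_or (B1 r) (B2 r))) => a x.
split=> [[r [[y [_ _ Gy]]|[y [_ _ _ Gy]]]]|[y Gy]]; try by exists y.
have [r ler [[beta [fb van]] nge]] := exact_rank q (oapp x y).
exists (Ordinal (ler : (r < (len q).+1)%N)) => /=.
have [gy|ngy] := EM (gen x y); [left|right]; exists y; split=> //.
  by exists beta; apply: free_type_basis.
by exists beta.
Qed.

Lemma bdd_renK (V W W' : finType) (s : W -> W') (G : (V -> F) -> (W -> K) -> Prop) :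
  bdd chi G -> bdd chi (fun a x => G a (x \o s)).
Proof.
elim=> {V G} [V D dD|V p Hp|V G _ IH|V G H _ IHG _ IHH|V G _ IH].
- exact: BddF.
- exact: BddP (pfun_ren id s Hp).
- exact: BddN.
- exact: (BddI IHG IHH).
- exact: (BddX IH).
Qed.

Section Formulas.

Definition term_spec m n s : term m n s -> Prop :=
  match s with
  | SortF => fun t => exists f : ('I_m -> F) -> F, fterm f /\
      forall a (x : 'I_n -> K), eval chi (mktuple a) (mktuple x) t = f a
  | SortK => fun t => pfun chi (fun a x => eval chi (mktuple a) (mktuple x) t : K)
  end.

Lemma termP m n s (t : term m n s) : term_spec t.
Proof.
elim: t => [i|i|[]|[]|[] t Ht u Hu|[] t Ht|[] t Ht u Hu|t [f [Hf ft]]] /=.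
- by exists (fun a => a i); split=> [|a x]; [apply: FVar|rewrite tnth_mktuple].
- rewrite (_ : (fun a x => _) = fun (_ : 'I_m -> F) x => x i); first exact: PVar.
  by apply: funext => a; apply: funext => x; rewrite tnth_mktuple.
- by exists (fun=> 0); split=> //; apply: FZero.
- exact: PZero.
- by exists (fun=> 1); split=> //; apply: FOne.
- exact: POne.
- have [f [Hf ft]] := Ht; have [g [Hg gu]] := Hu.
  exists (fun a => f a + g a); split=> [|a x]; first exact: FAdd.
  by rewrite ft gu.
- exact: PAdd.
- have [f [Hf ft]] := Ht.
  exists (fun a => - f a); split=> [|a x]; first exact: FOpp.
  by rewrite ft.
- exact: POpp.
- have [f [Hf ft]] := Ht; have [g [Hg gu]] := Hu.
  exists (fun a => f a * g a); split=> [|a x]; first exact: FMul.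
  by rewrite ft gu.
- exact: PMul.
- rewrite (_ : (fun a x => _) = fun a (_ : 'I_n -> K) => chi (f a)).
    exact: PChi.
  by apply: funext => a; apply: funext => x; rewrite ft.
Qed.

Lemma mktuple_cons A n (a : 'I_n -> A) b :
  cons_tuple b (mktuple a) = mktuple (oapp a b \o unlift ord0).
Proof.
apply: eq_from_tnth => i; rewrite tnth_mktuple /=.
by case: unliftP => [j ->|->] //=; rewrite tnthS tnth_mktuple.
Qed.

Lemma bdd_holds m n (f : formula m n) :
  bdd chi (fun a x => holds chi (mktuple a) (mktuple x) f).
Proof.
elim: f => {m n} [m n [] t u|m n f IH|m n f IHf g IHg|m n f IH|m n f IH] /=.
- have [f [Hf ft]] := termP t; have [g [Hg gu]] := termP u.
  apply: bdd_ext (BddF _ (dfn_fterm chi void Hf Hg)) => a x.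
  by rewrite ft gu.
- apply: bdd_ext (BddP (PAdd (termP t) (POpp (termP u)))) => a x.
  by split=> [/eqP|->]; rewrite ?subrr // subr_eq0 => /eqP.
- exact: BddN.
- exact: (BddI IHf IHg).
- apply: bdd_ext (BddX (bdd_ren (unlift ord0) IH)) => a x.
  by split=> -[b Hb]; exists b; move: Hb; rewrite mktuple_cons.
- apply: bdd_ext (bdd_exK (bdd_renK (unlift ord0) IH)) => a x.
  by split=> -[b Hb]; exists b; move: Hb; rewrite mktuple_cons.
Qed.

End Formulas.

End EliminationK.

(** * Algebraically presentable sets *)

Section Presentable.
Local Open Scope ring_scope.
Local Open Scope classical_set_scope.
Variables (F : fieldType) (K : closedFieldType) (chi : F -> K).
Variables (PF PK : finType) (pa : PF -> F) (pd : PK -> K).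
Variable dfn' : forall m n, set (m.-tuple F * n.-tuple K) -> Prop.
Hypothesis dfn'P : forall m n (G : ('I_m + PF -> F) -> ('I_n + PK -> K) -> Prop),
  dfn chi G -> dfn' [set u | G (join (tnth u.1) pa) (join (tnth u.2) pd)].

Lemma pfun_mpoly n (V : finType) (p : (V -> F) -> ('I_n + PK -> K) -> K) a : pfun chi p ->
  exists P : {mpoly K[n]}, forall x : n.-tuple K, p a (join (tnth x) pd) = P.@[tnth x].
Proof.
elim=> [f _|[i|k]|||g h _ [P HP] _ [Q HQ]|g _ [P HP]|g h _ [P HP] _ [Q HQ]].
- by exists (chi (f a))%:MP => x; rewrite mevalC.
- by exists 'X_i => x; rewrite mevalXU.
- by exists (pd k)%:MP => x; rewrite mevalC.
- by exists 0 => x; rewrite meval0.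
- by exists 1 => x; rewrite meval1.
- by exists (P + Q) => x; rewrite mevalD HP HQ.
- by exists (- P) => x; rewrite mevalN HP.
- by exists (P * Q) => x; rewrite mevalM HP HQ.
Qed.

(** The shape of all presentable sets below.  The class [dfn'] stands for definability with
parameters [pa] and [pd], so that both halves of the theorem are treated at once. *)
Lemma presentable_family n (I T : finType) (D : (T + PF -> F) -> Prop)
    (p : I -> (T -> F) -> ('I_n + PK -> K) -> K) :
  dfnF chi D -> (forall i, pfun chi (p i)) ->
  presentable dfn' [set x : n.-tuple K | exists b : T -> F, D (join b pa) /\
    forall i, p i b (join (tnth x) pd) = 0].
Proof.
move=> dD Hp; exists #|T|.
pose fn (t : #|T|.-tuple F) : T -> F := fun v => tnth t (enum_rank v).
exists [set t | D (join (fn t) pa)].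
exists (fun t => [set x | forall i, p i (fn t) (join (tnth x) pd) = 0]).
pose r (w : T + PF) : 'I_#|T| + PF :=
  match w with inl v => inl (enum_rank v) | inr c => inr c end.
have rE t : join (tnth t) pa \o r = join (fn t) pa by apply: funext => -[].
split.
- rewrite (_ : setF _ _ = [set u : #|T|.-tuple F * 0.-tuple K |
      (fun e _ => D (e \o r)) (join (tnth u.1) pa) (join (tnth u.2) pd)]).
    apply: (dfn'P (G := fun e _ => D (e \o r))).
    exact: (dfn_ren r (fun v : void => match v with end) dD).
  apply/seteqP; split=> [[t x] /= [Dt _]|[t x] /= Dt].
    by rewrite rE.
  by split=> //; move: Dt; rewrite rE.
- rewrite (_ : [set u | _] = [set u : #|T|.-tuple F * n.-tuple K |
      (fun e x => D (e \o r) /\ forall i, p i (e \o inl \o enum_rank) x = 0)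
      (join (tnth u.1) pa) (join (tnth u.2) pd)]).
    apply: (dfn'P (G := fun e x => D (e \o r) /\
      forall i, p i (e \o inl \o enum_rank) x = 0)); apply: dfn_and.
      exact: (dfn_ren r (fun v : void => match v with end) dD).
    apply: dfn_all => i; apply: dfn_pfun; last exact: PZero.
    exact: (pfun_ren (inl \o enum_rank) id (Hp i)).
  by apply/seteqP; split=> -[t x] /=; rewrite rE.
- move=> t _; exists [set P | exists i, forall x : n.-tuple K,
     p i (fn t) (join (tnth x) pd) = P.@[tnth x]].
  apply/seteqP; split=> [x /= px P [i Pi]|x /= H i]; first by rewrite -Pi.
  have [P HP] := pfun_mpoly (fn t) (Hp i).
  by rewrite HP; apply: H; exists i.
apply/seteqP; split=> [x [b [Db pb]]|x [t /= Dt px]]; last by exists (fn t).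
have bE : fn (mktuple (b \o enum_val)) = b.
  by apply: funext => v; rewrite /fn tnth_mktuple /= enum_rankK.
by exists (mktuple (b \o enum_val)); rewrite /= bE.
Qed.

Hypotheses (chi0 : chi 0 = 0) (chi1 : chi 1 = 1).

Lemma boolean_combination_ex (T : Type) (C : set T -> Prop) N (S : nat -> set T) :
  (forall r, boolean_combination C (S r)) ->
  boolean_combination C [set x | exists2 r, (r <= N)%N & S r x].
Proof.
move=> HS; elim: N => [|N IHN].
  rewrite (_ : [set x | _] = S 0%N) //; apply/seteqP; split=> x /=.
    by case=> r; rewrite leqn0 => /eqP ->.
  by exists 0%N.
rewrite (_ : [set x | _] = [set x | exists2 r, (r <= N)%N & S r x] `|` S N.+1).
  exact: BoolU.
apply/seteqP; split=> x /=.
  by case=> r; rewrite leq_eqVlt => /predU1P[->|ltr] Sr; [right|left; exists r].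
by case=> [[r ler Sr]|Sx]; [exists r; rewrite // leqW|exists N.+1].
Qed.

(** Cut the space into the strata [A r] minus [A r.+1], where type bases have size [r].  On a
stratum a free vanishing family of size [r] is automatically a type basis, so that [G]
becomes the existence of one with property [D], which is a presentable condition. *)
Lemma bdd_boolean_combination n (G : (PF -> F) -> ('I_n + PK -> K) -> Prop) :
  bdd chi G ->
  boolean_combination (@presentable F K dfn' n)
    [set x : n.-tuple K | G pa (join (tnth x) pd)].
Proof.
move=> /(bdd_type chi0 chi1)[q detG].
pose A r := [set x : n.-tuple K | rank_ge q r (join (tnth x) pd)].
have HA r : presentable dfn' (A r).
  pose p i (b : 'I_r * par q -> F) (x : 'I_n + PK -> K) := value (row_of b i) x.
  have Hp i : pfun chi (p i).
    by apply: (pfun_value (s := fun t b => b (i, t))) => t; apply: FVar.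
  have dfree : dfnF chi (fun e : 'I_r * par q + PF -> F => free (e \o inl)).
    by apply: (dfnF_free (bf := fun it e => e (inl it))) => it; apply: FVar.
  exact: presentable_family dfree Hp.
have HS r : exists S, presentable dfn' S /\ A r `&` ~` A r.+1 `&` S =
    A r `&` ~` A r.+1 `&` [set x : n.-tuple K | G pa (join (tnth x) pd)].
  have [D [dD DE]] := detG r.
  pose p i (b : 'I_r * par q -> F) (x : 'I_n + PK -> K) := value (row_of b i) x.
  have Hp i : pfun chi (p i).
    by apply: (pfun_value (s := fun t b => b (i, t))) => t; apply: FVar.
  have dfree : dfnF chi (fun e : 'I_r * par q + PF -> F =>
      free (e \o inl) /\ D (e \o inr) (e \o inl)).
    apply: dfn_and.
      by apply: (dfnF_free (bf := fun it e => e (inl it))) => it; apply: FVar.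
    exact: (dfnF_ren (fun w => match w with inl v => inr v | inr it => inl it end) dD).
  eexists; split; first exact: presentable_family dfree Hp.
  apply/seteqP; split=> x /= [[Ax nA]].
    case=> b [[fb Db] van]; split=> //.
    by apply/(DE _ _ _ (free_type_basis fb van nA)).
  move=> Gx; split=> //; have [b [fb van]] := Ax.
  exists b; split=> //; split=> //.
  by apply/(DE _ _ _ (free_type_basis fb van nA)).
have HS' r : boolean_combination (@presentable F K dfn' n)
    (A r `&` ~` A r.+1 `&` [set x : n.-tuple K | G pa (join (tnth x) pd)]).
  have [S [pS <-]] := HS r.
  by apply: BoolI; [apply: BoolI; [|apply: BoolC]|]; apply: BoolGen.
have := boolean_combination_ex (len q) HS'.
congr boolean_combination; apply/seteqP; split=> x /=; first by case=> r _ [].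
move=> Gx; have [r ler [Ar nA]] := exact_rank q (join (tnth x) pd).
by exists r.
Qed.

End Presentable.

Section DefinableClasses.
Local Open Scope classical_set_scope.
Variables (F : fieldType) (K : closedFieldType) (chi : F -> K).

Lemma tnth_cat (A : Type) m m' (a : m.-tuple A) (c : m'.-tuple A) :
  tnth (cat_tuple a c) = join (tnth a) (tnth c) \o @split m m'.
Proof.
apply: funext => i; rewrite /= -[in LHS](splitK i); case: (split i) => j /=.
  exact: tnth_lshift.
exact: tnth_rshift.
Qed.

Lemma dfn_definable m' n' (c : m'.-tuple F) (d : n'.-tuple K) m n
    (G : ('I_m + 'I_m' -> F) -> ('I_n + 'I_n' -> K) -> Prop) : dfn chi G ->
  definable chi [set u : m.-tuple F * n.-tuple K |
    G (join (tnth u.1) (tnth c)) (join (tnth u.2) (tnth d))].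
Proof.
move=> /(dfn_ren (@unsplit m m') (@unsplit n n'))/dfn_ord[f Hf].
exists m', n', c, d, f; apply/seteqP.
have catE A k k' (u : k.-tuple A) (v : k'.-tuple A) :
    tnth (cat_tuple u v) \o @unsplit k k' = join (tnth u) (tnth v).
  by rewrite tnth_cat; apply: funext => w; rewrite /= unsplitK.
by split=> -[a x] /=; rewrite -Hf !catE.
Qed.

Lemma dfn_definable0 m n
    (G : ('I_m + void -> F) -> ('I_n + void -> K) -> Prop) : dfn chi G ->
  definable0 chi [set u : m.-tuple F * n.-tuple K |
    G (join (tnth u.1) (of_void F)) (join (tnth u.2) (of_void K))].
Proof.
pose r k (w : 'I_k + void) : 'I_k := match w with inl i => i | inr v => of_void _ v end.
move=> /(dfn_ren (@r m) (@r n))/dfn_ord[f Hf].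
exists f; apply/seteqP.
have rE A k (u : 'I_k -> A) : u \o @r k = join u (of_void A).
  by apply: funext => -[|[]].
by split=> -[a x] /=; rewrite -Hf !rE.
Qed.

End DefinableClasses.

Theorem theorem1p8 (p : nat) (hp : prime p \/ p = 0%N)
    (F K : closedFieldType) (chi : F -> K) (hM : ACFC_model p chi)
    (n : nat) (X : set (n.-tuple K)) :
  (definable chi (setK F X) ->
     boolean_combination (algebraically_presentable chi) X) /\
  (definable0 chi (setK F X) ->
     boolean_combination (algebraically_presentable0 chi) X).
Proof.
case: hM => K0 chi_gen _; have [[chiM chi0 chi1] _ _] := chi_gen.
split.
  case=> m' [n' [c [d [f Xf]]]].
  have B := bdd_renK (@split n n') (bdd_holds chi_gen K0 f).
  have := bdd_boolean_combination
    (fun m k => @dfn_definable F K chi m' n' c d m k) chi0 chi1 B.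
  congr boolean_combination; apply/seteqP.
  have XE x : X x <-> holds chi c (cat_tuple x d) f.
    have -> : X x = setK F X ([tuple], x).
      by rewrite /setK /=; apply: propext; split=> [|[]].
    rewrite Xf /=; have -> : cat_tuple [tuple] c = c by exact: val_inj.
    by [].
  have cE : mktuple (tnth c) = c by apply: eq_from_tnth => i; rewrite tnth_mktuple.
  have dE (x : n.-tuple K) :
      mktuple (join (tnth x) (tnth d) \o @split n n') = cat_tuple x d.
    by apply: eq_from_tnth => i; rewrite tnth_mktuple tnth_cat.
  by split=> x /=; rewrite cE dE => /XE.
case=> f Xf.
pose no_var (i : 'I_0) : void :=
  match i with Ordinal _ h => False_rect void (notF h) end.
have B := bdd_renK (fun i : 'I_n => inl i : 'I_n + void)
  (bdd_ren no_var (bdd_holds chi_gen K0 f)).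
have := bdd_boolean_combination (fun m k => @dfn_definable0 F K chi m k) chi0 chi1 B.
congr boolean_combination; apply/seteqP.
have XE x : X x <-> holds chi [tuple] x f.
  have -> : X x = setK F X ([tuple], x).
    by rewrite /setK /=; apply: propext; split=> [|[]].
  by rewrite Xf.
have aE (a : 'I_0 -> F) : mktuple a = [tuple] by rewrite tuple0.
have xE (x : n.-tuple K) : mktuple (join (tnth x) (of_void K) \o inl) = x.
  by apply: eq_from_tnth => i; rewrite tnth_mktuple.
by split=> x /=; rewrite aE xE => /XE.
Qed.
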